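(* If a set of $m$ spherical caps, each of normalized volume $\delta$ with $2^{-o(\sqrt{n})} \leq \delta < \frac{1}{2}$, covers $S^{n-1}$, then \[\delta \geq \Omega\left(\frac{n}{m\sqrt{\log\left(1 + \frac{m}{n}\right)}}\right).\]
   Context: $S^{n-1} = \{x \in \mathbb{R}^n : \|x\|_2 = 1\}$. The spherical cap with pole $v \in S^{n-1}$ and angular radius $\theta$ is $\{x \in S^{n-1} : \langle x, v\rangle \geq \cos\theta\}$. The normalized volume of a measurable set $C \subseteq S^{n-1}$ is $\Pr_{x}[x \in C]$ for $x$ uniformly distributed on $S^{n-1}$. Asymptotic notation is as $n \to \infty$, with $m$ and $\delta$ functions of $n$; $\log$ is base $2$. *)

(* Defs.v *)
From HB Require Import structures.
From mathcomp Require Export all_boot all_order all_algebra.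
From mathcomp Require Export all_classical all_reals all_analysis.
Export Order.TTheory GRing.Theory Num.Theory.
Export numFieldNormedType.Exports.

Set Implicit Arguments.
Unset Strict Implicit.
Unset Printing Implicit Defensive.

Local Open Scope classical_set_scope.
Local Open Scope ring_scope.

Definition inner (R : realType) (n : nat) (x y : 'rV[R]_n) : R :=
  \sum_(i < n) x ord0 i * y ord0 i.

(* S^{n-1}; the norm of the library on 'rV[R]_n is the sup norm, so the
   Euclidean norm is written out. *)
Definition sphere (R : realType) (n : nat) : set 'rV[R]_n :=
  [set x | Num.sqrt (inner x x) = 1].

Definition cap (R : realType) (n : nat) (v : 'rV[R]_n) (theta : R) :
    set 'rV[R]_n :=
  [set x | sphere x /\ cos theta <= inner x v].

Definition is_cap (R : realType) (n : nat) (C : set 'rV[R]_n) : Prop :=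
  exists v : 'rV[R]_n, exists theta : R,
    [/\ sphere v, 0 <= theta <= pi & C = cap v theta].

(* n-dimensional Lebesgue measure, as an iterated integral over the successive
   coordinates; it is only meaningful on Borel sets. *)
Fixpoint lebesgue_rV (R : realType) (n : nat) : set 'rV[R]_n -> \bar R :=
  if n is n'.+1 then fun A : set 'rV[R]_(1 + n') =>
    (\int[@lebesgue_measure R]_(x in setT)
       lebesgue_rV [set y : 'rV[R]_n' | A (row_mx (x%:M : 'rV[R]_1) y)])%E
  else fun A => (\1_A 0)%:E.

(* The part in the unit ball of the cone spanned by C. *)
Definition ball_cone (R : realType) (n : nat) (C : set 'rV[R]_n) :
    set 'rV[R]_n :=
  [set t *: x | t in [set t : R | 0 < t <= 1] & x in C].

(* Pr[x \in C] for x uniform on S^{n-1}: such an x is y / |y| for y uniform in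
   the unit ball. The origin, a null set for 0 < n, is left out of both cones. *)
Definition normalized_volume (R : realType) (n : nat) (C : set 'rV[R]_n) : R :=
  fine (lebesgue_rV (ball_cone C)) / fine (lebesgue_rV (ball_cone (@sphere R n))).

Definition log2 (R : realType) (x : R) : R := ln x / ln 2.

(* Main.v *)
Require Import Defs.
From HB Require Import structures.
From mathcomp Require Import measurable_realfun.
From mathcomp Require Import ring lra.

(** Let [v_j] be the poles and [r > 0] the least cosine of an angular radius, so
    that every [w] has [r |w| <= <v_j, w>] for some [j], and put [t = r sqrt n].
    The map [w |-> eps w + \sum_j c (<v_j, w> - 1)_+ v_j] is strongly monotone and
    Lipschitz, hence invertible.  With [a_j x = c (<v_j, w x> - 1)_+], where [w x]
    is the preimage of [x], it decomposes [x], up to [eps w x], as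
    [\sum_j a_j x v_j] with nonnegative coefficients of sum at most
    [|x| / r + O(1 / c)], and monotonicity gives
    [a_j (x + tau v_j) <= a_j x + tau] for [tau >= 0].  For a standard Gaussian
    vector [x], integrating this slope condition along the lines of direction
    [v_j] yields [E (a_j x (1 - M <x, v_j>)) >= - K], where [M = Q b / phi b] is
    the Mills ratio at a free parameter [b >= 1] and [K = M Q b - phi b + b Q b].
    Summing over [j], then [eps -> 0] and [c -> oo], gives
    [M n <= n / t + m K], and [b = t - 3 / t] turns this into
    [n <= 4 m phi b / t].  A cap has the Gaussian volume of a cone of height
    [r], which is at least a constant times [phi b / t] when [t ^ 4 <= n]; the
    lower bound on [delta] forces [t ^ 4 <= n] for large [n].  Therefore
    [delta >= k n / m] for a constant [k]; the logarithm is at least [1] because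
    a cover needs [n <= m]. *)

(** The coefficients come from linear programming. The covering says that the polytope of all [w]
    with [<v_j, w> <= 1] for every [j] lies in the ball of radius [1 / r], so by duality every [x]
    is a nonnegative combination of poles of total weight at most [|x| / r]. The Gaussian
    integration needs weights that are measurable in [x] and have slope at most one along their own
    pole; optimal weights are not unique and would have to be selected. The penalty [c] and the
    regularization [eps] replace them by the multipliers of a strongly convex problem, where both
    properties follow from monotonicity. The inequality weighs the total weight, of mean at most
    [sqrt n / r = n / t], against [\sum_j a_j <x, v_j>], of mean about [n]. Everything rests on
    taking [M] only slightly larger than [1 / t]: the gain per dimension [M - 1 / t] has order
    [t^-3], the loss [K] per cap has order [phi b t^-4], and their quotient is the volume of a cap
    up to a constant. The condition [t ^ 4 <= n] is where the cap and a one-dimensional Gaussian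
    tail agree up to a constant: the square of the threshold of the cap exceeds [t ^ 2] by about
    [t ^ 4 / n]. *)

Set Implicit Arguments.
Unset Strict Implicit.
Unset Printing Implicit Defensive.

Local Open Scope classical_set_scope.
Local Open Scope ring_scope.

(** * Power measures on row vectors *)

Section rV_measurable.
Variables (R : realType) (n : nat).

Let coord (i : 'I_n) (x : 'rV[R]_n) : measurableTypeR R := x ord0 i.

Let rV_set0 : g_sigma_preimage coord set0.
Proof. exact: sigma_algebra0. Qed.

Let rV_setC A : g_sigma_preimage coord A -> g_sigma_preimage coord (~` A).
Proof. exact: sigma_algebraC. Qed.

Let rV_bigcup (F : (set 'rV[R]_n)^nat) :
  (forall i, g_sigma_preimage coord (F i)) ->
  g_sigma_preimage coord (\bigcup_i F i).
Proof. exact: sigma_algebra_bigcup. Qed.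

HB.instance Definition _ := @isMeasurable.Build default_measure_display
  ('rV[R]_n) (g_sigma_preimage coord) rV_set0 rV_setC rV_bigcup.

Lemma measurable_coord (i : 'I_n) :
  measurable_fun [set: 'rV[R]_n] (fun x : 'rV[R]_n => x ord0 i).
Proof.
move=> _ Y mY; rewrite setTI; apply: sub_sigma_algebra => /=.
rewrite -bigcup_seq/=; exists i => /=; first by rewrite mem_index_enum.
by exists Y => //; rewrite setTI.
Qed.

Lemma measurable_rVP d (T : measurableType d) (f : T -> 'rV[R]_n) :
  (forall i, measurable_fun [set: T] (fun t => f t ord0 i)) ->
  measurable_fun [set: T] f.
Proof.
move=> mf _ Y mY; rewrite setTI.
suff: g_sigma_preimage (fun i t => coord i (f t)) `<=` measurable.
  by rewrite g_sigma_preimage_comp; apply; exists Y => //; rewrite setTI.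
apply: smallest_sub; first exact: sigma_algebra_measurable.
rewrite -bigcup_seq; apply: bigcup_sub => i _ A [B mB <-].
exact: mf.
Qed.

End rV_measurable.

Section cons_row.
Variables (R : realType) (n : nat).

(** Uses the same [row_mx] as [lebesgue_rV], so that [lebesgue_rVE] reduces to unfolding both
    iterated integrals. *)
Definition cons_row (p : measurableTypeR R * 'rV[R]_n) : 'rV[R]_n.+1 :=
  row_mx (p.1%:M : 'rV[R]_1) p.2.

Lemma cons_row0 p : cons_row p ord0 ord0 = p.1.
Proof.
transitivity ((row_mx (p.1%:M : 'rV[R]_1) p.2) ord0 (lshift n ord0)).
  by congr (row_mx _ _ _ _); exact/val_inj.
by rewrite row_mxEl mxE eqxx mulr1n.
Qed.

Lemma cons_rowS p i : cons_row p ord0 (lift ord0 i) = p.2 ord0 i.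
Proof.
transitivity ((row_mx (p.1%:M : 'rV[R]_1) p.2) ord0 (rshift 1 i)).
  by congr (row_mx _ _ _ _); exact/val_inj.
by rewrite row_mxEr.
Qed.

Lemma measurable_cons_row : measurable_fun [set: measurableTypeR R * 'rV[R]_n] cons_row.
Proof.
apply: measurable_rVP => i; case: (unliftP ord0 i) => [j|] ->.
  under eq_fun do rewrite cons_rowS.
  apply: (@measurableT_comp _ _ _ _ _ _ (fun x : 'rV[R]_n => x ord0 j)) => //.
  exact: measurable_coord.
by under eq_fun do rewrite cons_row0; exact: measurable_fst.
Qed.

Lemma measurable_behead_row :
  measurable_fun [set: 'rV[R]_n.+1]
    (fun x => (\row_i x ord0 (lift ord0 i)) : 'rV[R]_n).
Proof.
apply: measurable_rVP => i; under eq_fun do rewrite mxE.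
exact: measurable_coord.
Qed.

Lemma cons_rowK (x : 'rV[R]_n.+1) :
  cons_row (x ord0 ord0, \row_i x ord0 (lift ord0 i)) = x.
Proof.
apply/rowP => i; case: (unliftP ord0 i) => [j|] ->.
  by rewrite cons_rowS mxE.
by rewrite cons_row0.
Qed.

End cons_row.

Section power_measure.
Variables (R : realType) (mu : {sigma_finite_measure set (measurableTypeR R) -> \bar R}).
Local Open Scope ereal_scope.

Section step.
Variables (n : nat) (nu : {sigma_finite_measure set 'rV[R]_n -> \bar R}).

Definition cons_measure : set 'rV[R]_n.+1 -> \bar R :=
  pushforward (mu \x nu) (@cons_row R n).

HB.instance Definition _ := Measure.copy cons_measure
  (measure_function_pushforward__canonical__measure_function_Measure
     (mu \x nu) (@measurable_cons_row R n)).

Let cons_measure_sigma_finite : sigma_finite setT cons_measure.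
Proof.
have [F TF Ffin] := sigma_finiteT mu; have [G TG Gfin] := sigma_finiteT nu.
(* The finite boxes are products of members of the two exhausting sequences; [h] enumerates the
   pairs of indices. *)
have /card_esym/ppcard_eqP[h] := card_nat2.
pose u (x : 'rV[R]_n.+1) : measurableTypeR R * 'rV[R]_n :=
  (x ord0 ord0, (\row_i x ord0 (lift ord0 i))%R).
have mu_ : measurable_fun setT u.
  apply: measurable_fun_pair; first exact: measurable_coord.
  exact: measurable_behead_row.
have uK p : u (cons_row p) = p.
  case: p => x y; rewrite /u cons_row0; congr pair.
  by apply/rowP => i; rewrite mxE cons_rowS.
exists (fun k => u @^-1` (F (h k).1 `*` G (h k).2)).
  rewrite -preimage_bigcup -[LHS](preimage_setT u); congr (_ @^-1` _).
  apply/seteqP; split => // -[x y] _.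
  have [i _ Fi] : (\bigcup_i F i) x by rewrite -TF.
  have [j _ Gj] : (\bigcup_i G i) y by rewrite -TG.
  by exists (h^-1 (i, j))%FUN => //=; rewrite invK// inE.
move=> k; have [mF Fk] := Ffin (h k).1; have [mG Gk] := Gfin (h k).2; split.
  by rewrite -[X in measurable X]setTI; apply: mu_ => //; exact: measurableX.
rewrite /cons_measure /pushforward/=.
rewrite (_ : @cons_row R n @^-1` _ = F (h k).1 `*` G (h k).2).
  by rewrite product_measure1E// lte_mul_pinfty// ge0_fin_numE.
rewrite -comp_preimage (_ : u \o @cons_row R n = id)//.
by apply/funext => p; exact: uK.
Qed.

HB.instance Definition _ := Measure_isSigmaFinite.Build _ _ _ cons_measure
  cons_measure_sigma_finite.

End step.

(** One construction serves both Lebesgue measure, in which [normalized_volume] is expressed, and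
    the standard Gaussian measure. Sigma-finiteness is carried along for the sake of Tonelli. *)
Fixpoint rV_measure n : {sigma_finite_measure set 'rV[R]_n -> \bar R} :=
  if n is n'.+1 then cons_measure (rV_measure n') else \d_(0%R : 'rV[R]_0).

Lemma rV_measureS n (A : set 'rV[R]_n.+1) :
  rV_measure n.+1 A =
  \int[mu]_x rV_measure n [set y | A (cons_row (x, y))].
Proof.
apply: eq_integral => x _ /=; congr (rV_measure n _).
by apply/seteqP; split => y; rewrite /xsection /= inE.
Qed.

Lemma ge0_integral_rVS n (f : 'rV[R]_n.+1 -> \bar R) :
  measurable_fun setT f -> (forall x, 0 <= f x) ->
  \int[rV_measure n.+1]_x f x =
  \int[mu]_x \int[rV_measure n]_y f (cons_row (x, y)).
Proof.
move=> mf f0.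
rewrite (@ge0_integral_pushforward _ _ _ _ _ _ (@measurable_cons_row R n))//.
rewrite preimage_setT fubini_tonelli1//; last by move=> x; exact: f0.
by apply: measurableT_comp => //; exact: measurable_cons_row.
Qed.

(** With the first coordinate innermost, one-dimensional Gaussian estimates apply for fixed values
    of the others. *)
Lemma ge0_integral_rVS_swap n (f : 'rV[R]_n.+1 -> \bar R) :
  measurable_fun setT f -> (forall x, 0 <= f x) ->
  \int[rV_measure n.+1]_x f x =
  \int[rV_measure n]_y \int[mu]_x f (cons_row (x, y)).
Proof.
move=> mf f0; rewrite ge0_integral_rVS//.
rewrite (fubini_tonelli (f \o @cons_row R n))//; last by move=> x; exact: f0.
by apply: measurableT_comp => //; exact: measurable_cons_row.
Qed.

Lemma rV_measure_setT n : mu setT = 1 -> rV_measure n setT = 1.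
Proof.
move=> mu1; elim: n => [|n IH]; first by rewrite /= diracT.
rewrite rV_measureS (eq_integral (cst 1)).
  by rewrite integral_cst// mul1e.
move=> x _; rewrite -[RHS]IH; congr (rV_measure n _).
Qed.

End power_measure.

Lemma lebesgue_rVE (R : realType) n (A : set 'rV[R]_n) :
  lebesgue_rV A = rV_measure (@lebesgue_measure R) n A.
Proof.
elim: n A => [|n IH] A; first by rewrite /= diracE indicE.
rewrite rV_measureS; apply: eq_integral => x _; exact: IH.
Qed.

(** * One-dimensional Gaussian estimates *)

Section gauss1.
Import HBNNSimple.
Variable R : realType.
Local Notation mu := (@lebesgue_measure R).
Local Notation N := (@normal_prob R 0 1).
Local Notation phi := (@normal_pdf R 0 1).
Local Notation kappa := (@normal_peak R 1).

Lemma phiE x : phi x = kappa * expR (- (x ^+ 2) / 2).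
Proof.
rewrite normal_pdfE ?oner_neq0// /normal_fun subr0 expr1n.
by rewrite mulr2n (_ : 1 + 1 = 2).
Qed.

Lemma kappa_gt0 : 0 < kappa. Proof. by rewrite normal_peak_gt0// oner_neq0. Qed.

Lemma phi_gt0 x : 0 < phi x.
Proof. by rewrite phiE mulr_gt0 ?kappa_gt0 ?expR_gt0. Qed.

Lemma phi_le x y : 0 <= x -> x <= y -> phi y <= phi x.
Proof.
move=> x0 xy; rewrite !phiE ler_pM2l ?kappa_gt0// ler_expR.
by rewrite ler_pM2r ?invr_gt0// lerN2 ler_sqr// nnegrE// (le_trans x0).
Qed.

Lemma is_derive_phi (x : R) : is_derive x 1 phi (- x * phi x).
Proof.
rewrite (_ : phi = fun x => kappa * expR (- (x ^+ 2) / 2)); last first.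
  by apply/funext => y; exact: phiE.
apply: is_derive_eq.
rewrite /GRing.scale/= !mulr0 ?mulr1 ?addr0 ?add0r; by field.
Qed.

Let integral_normal_nnsfun (f : {nnsfun (measurableTypeR R) >-> R}) :
  (\int[N]_x (f x)%:E = \int[mu]_x ((f x)%:E * (phi x)%:E))%E.
Proof.
have p0 x : (0 <= (phi x)%:E)%E by rewrite lee_fin normal_pdf_ge0.
have mp : measurable_fun [set: measurableTypeR R] (fun x => (phi x)%:E).
  by apply/measurable_EFinP; exact: measurable_normal_pdf.
under [LHS]eq_integral do rewrite fimfunE -fsumEFin//.
under [RHS]eq_integral.
  move=> x _; rewrite fimfunE -fsumEFin// ge0_mule_fsuml; last first.
    by move=> r; rewrite EFinM nnfun_muleindic_ge0.
  over.
have mi r : measurable_fun [set: measurableTypeR R]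
    (fun x => (r * \1_(f @^-1` [set r]) x)%:E).
  by apply/measurable_EFinP; apply: measurable_funM => //; exact: measurable_indic.
rewrite !ge0_integral_fsum//=; last 3 first.
- by move=> r; apply: emeasurable_funM.
- by move=> r x _; rewrite mule_ge0// EFinM nnfun_muleindic_ge0.
- by move=> r x _; rewrite EFinM nnfun_muleindic_ge0.
apply: eq_fsbigr => r _.
have [r0|r0] := ltP r 0.
  rewrite !integral0_eq// => x _; rewrite preimage_nnfun0// indic0 mulr0//.
  by rewrite mul0e.
under [LHS]eq_integral do rewrite EFinM.
under [RHS]eq_integral do rewrite EFinM -muleA.
have mI : measurable_fun [set: measurableTypeR R] (fun x => (\1_(f @^-1` [set r]) x)%:E :
    \bar R).
  by apply/measurable_EFinP; exact: measurable_indic.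
rewrite !ge0_integralZl//=; last 2 first.
- by apply: emeasurable_funM.
- by move=> x _; rewrite mule_ge0// lee_fin.
congr (_ * _)%E.
rewrite integral_indic// setIT /normal_prob [LHS]integral_mkcond.
by apply: eq_integral => x _; rewrite epatch_indic muleC.
Qed.

Lemma ge0_integral_normal (f : measurableTypeR R -> \bar R) :
  measurable_fun [set: measurableTypeR R] f ->
  (forall x, (0 <= f x)%E) ->
  (\int[N]_x f x = \int[mu]_x (f x * (phi x)%:E))%E.
Proof.
move=> mf f0.
have p0 x : (0 <= (phi x)%:E)%E by rewrite lee_fin normal_pdf_ge0.
have mp : measurable_fun [set: measurableTypeR R] (fun x => (phi x)%:E).
  by apply/measurable_EFinP; exact: measurable_normal_pdf.
pose f_ := nnsfun_approx measurableT mf.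
transitivity (lim (\int[N]_x (f_ n x)%:E @[n --> \oo])%E).
  rewrite -monotone_convergence//=.
  - apply: eq_integral => ? /[!inE] xD; apply/esym/cvg_lim => //=.
    exact: cvg_nnsfun_approx.
  - by move=> n; exact/measurable_EFinP/measurable_funTS.
  - by move=> n ? _; rewrite lee_fin.
  - by move=> ? _ ? ? mn; rewrite lee_fin; exact/lefP/nd_nnsfun_approx.
transitivity (lim (\int[mu]_x ((f_ n x)%:E * (phi x)%:E) @[n --> \oo])%E).
  by apply: congr_lim; apply/funext => n; exact: integral_normal_nnsfun.
rewrite -monotone_convergence//=.
- apply: eq_integral => x _; apply/cvg_lim => //=.
  apply: cvgeZr => //; exact: cvg_nnsfun_approx.
- by move=> n; apply: emeasurable_funM => //; exact/measurable_EFinP/measurable_funTS.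
- by move=> n x _; apply: mule_ge0 => //; rewrite lee_fin.
- by move=> x _ a b ab; rewrite lee_wpmul2r// lee_fin; exact/lefP/nd_nnsfun_approx.
Qed.

Lemma cvg_phi_bounded (P : R -> R) b :
  (forall x, b <= x -> 0 <= P x <= 1) ->
  P x * phi x @[x --> +oo] --> (0 : R).
Proof.
move=> Pb; apply: (@squeeze_cvgr _ _ _ _ (cst 0) (fun x => kappa * expR (- x))).
- near=> x.
  have /andP[P0 P1] : 0 <= P x <= 1 by apply: Pb; near: x; apply: nbhs_pinfty_ge; exact:
      num_real.
  (* From [2] on, [x ^+ 2 / 2 >= x], so [phi x] is below [kappa * expR (- x)]. *)
  have x2 : 2 <= x by near: x; apply: nbhs_pinfty_ge; exact: num_real.
  apply/andP; split; first by rewrite mulr_ge0// ltW// phi_gt0.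
  rewrite -[leRHS]mul1r; apply: ler_pM => //; first by rewrite ltW// phi_gt0.
  by rewrite phiE ler_pM2l ?kappa_gt0// ler_expR; nra.
- exact: cvg_cst.
- rewrite -[X in _ --> X](mulr0 kappa); apply: cvgMr; exact: cvgr_expR.
Unshelve. all: by end_near. Qed.

(** The integrand is the derivative of [- P * phi]. The constant [P = 1] gives the first moment of
    the tail; a rational [P] for which [x * P x - dP x] stays on one side of [1] gives a bound on
    [gtail]. *)
Lemma integral_phi_tail (P dP : R -> R) (b : R) :
  (forall x : R, b <= x -> is_derive x 1 P (dP x)) ->
  (forall x, b <= x -> 0 <= P x <= 1) ->
  (forall x, b <= x -> 0 <= x * P x - dP x) ->
  (forall x : R, b <= x -> derivable dP x 1) ->
  (\int[mu]_(x in `[b, +oo[) ((x * P x - dP x) * phi x)%:E = (P b * phi b)%:E)%E.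
Proof.
move=> dPx Pb pos cdP.
have dF (x : R) : b <= x ->
    is_derive x 1 (fun x => - (P x * phi x)) ((x * P x - dP x) * phi x).
  move=> bx; have ? := dPx _ bx; have ? := is_derive_phi x.
  by apply: is_derive_eq; rewrite /GRing.scale/=; ring.
have within (f : R -> R) : (forall x : R, b <= x -> derivable f x 1) ->
    {within `[b, +oo[, continuous f}.
  move=> df; apply: derivable_within_continuous => x; rewrite in_itv/= andbT.
  exact: df.
have cphi : continuous phi by apply: continuous_normal_pdf; rewrite oner_neq0.
rewrite (@ge0_continuous_FTC2y _ _ (fun x => - (P x * phi x)) b 0).
- by rewrite sub0e EFinN oppeK.
- by move=> x bx; rewrite mulr_ge0 ?pos// ltW// phi_gt0.
- move=> x; apply: cvgM; last exact: (continuous_subspaceT cphi).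
  apply: cvgB; last exact: (within _ cdP).
  apply: cvgM; last by apply: (within P) => y by_; have [] := dPx _ by_.
  by apply: (within (fun x => x)) => y _; exact: derivable_id.
- by rewrite -[X in _ --> X]oppr0; apply: cvgN; exact: (cvg_phi_bounded Pb).
- by move=> x /ltW bx; have := dF _ bx => -[].
- apply: cvg_at_right_filter; have [dd _] := dF _ (lexx b).
  by have /derivable1_diffP/differentiable_continuous := dd; exact.
- move=> x; rewrite in_itv/= andbT => /ltW bx.
  by rewrite derive1E; have [] := dF _ bx.
Qed.

Lemma measurable_phi : measurable_fun [set: R] phi.
Proof. exact: measurable_normal_pdf. Qed.

Lemma integral_normal_itv (b : R) (f : R -> R) : measurable_fun [set: R] f ->
  (forall x, b <= x -> 0 <= f x) ->
  (\int[N]_(x in `[b, +oo[) (f x)%:E =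
   \int[mu]_(x in `[b, +oo[) (f x * phi x)%:E)%E.
Proof.
move=> mf f0; rewrite integral_mkcond ge0_integral_normal; last 2 first.
- apply/(measurable_restrictT _ _).1 => //.
  by apply: measurable_funTS; exact/measurable_EFinP.
- move=> x; rewrite patchE; case: ifPn => // /[!inE]/=.
  by rewrite in_itv/= andbT lee_fin; exact: f0.
rewrite [RHS]integral_mkcond; apply: eq_integral => x _.
by rewrite !patchE; case: ifPn => _; rewrite ?mul0e.
Qed.

Definition gtail (b : R) : R := fine (N `[b, +oo[).

Lemma gtailE b : N `[b, +oo[ = (gtail b)%:E.
Proof. by rewrite /gtail fineK// fin_num_measure. Qed.

Lemma gtail_integral b : (\int[mu]_(x in `[b, +oo[) (phi x)%:E = (gtail b)%:E)%E.
Proof. by rewrite -gtailE. Qed.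

Lemma gtail_ge0 b : 0 <= gtail b. Proof. exact: fine_ge0. Qed.

Lemma integral_phi_id (b : R) : 0 <= b ->
  (\int[mu]_(x in `[b, +oo[) (x * phi x)%:E = (phi b)%:E)%E.
Proof.
move=> b0; have := @integral_phi_tail (fun=> 1) (fun=> 0) b.
rewrite mul1r => <-.
- by apply: eq_integral => x _; rewrite mulr1 subr0.
- by move=> x _; rewrite ler01 lexx.
- by move=> x bx; rewrite mulr1 subr0 (le_trans b0).
- by move=> x _; exact: derivable_cst.
Qed.

Lemma integral_normal_id (b : R) : 0 <= b ->
  (\int[N]_(x in `[b, +oo[) x%:E = (phi b)%:E)%E.
Proof.
move=> b0; rewrite integral_normal_itv//; first exact: integral_phi_id.
by move=> x; exact: le_trans.
Qed.

(** The factor is [1 / (b + 1 / b)], a convergent of Laplace's continued fraction for the Mills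
    ratio; its [x * P x - dP x] is [1] minus a positive term. *)
Lemma gtail_lower (b : R) : 1 <= b -> phi b * (b / (b ^+ 2 + 1)) <= gtail b.
Proof.
move=> b1; rewrite -lee_fin -gtail_integral mulrC.
pose P x : R := x / (x ^+ 2 + 1).
pose dP x : R := (1 - x ^+ 2) / (x ^+ 2 + 1) ^+ 2.
have x0 x : x ^+ 2 + 1 != 0 :> R by rewrite gt_eqF// ltr_wpDl ?sqr_ge0.
have E x : x * P x - dP x = 1 - 2 / (x ^+ 2 + 1) ^+ 2.
  by rewrite /P /dP; field; exact: x0.
have dPx (x : R) : is_derive x 1 P (dP x).
  rewrite /P; apply: is_derive_eq; rewrite /dP /GRing.scale/=.
  by field; exact: x0.
have ddP (x : R) : derivable dP x 1.
  have n0 : (x ^+ 2 + 1) ^+ 2 != 0 by rewrite expf_neq0.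
  by rewrite /dP; apply: ex_derive.
rewrite -(@integral_phi_tail P dP b)//.
- apply: ge0_le_integral => //=.
  + move=> x; rewrite in_itv/= andbT => bx; rewrite lee_fin mulr_ge0//.
      rewrite E subr_ge0 ler_pdivrMr; first by nra.
      by rewrite exprn_gt0// ltr_wpDl ?sqr_ge0.
    by rewrite ltW// phi_gt0.
  + apply/measurable_EFinP; apply: measurable_funTS.
    apply: measurable_funM; last exact: measurable_phi.
    by apply: continuous_measurable_fun => x; apply: differentiable_continuous;
      apply/derivable1_diffP; apply: derivableB => //; apply: derivableM => //;
      have [] := dPx x.
  + by apply/measurable_EFinP; apply: measurable_funTS; exact: measurable_phi.
  + move=> x _; rewrite lee_fin E ler_piMl// ?gerBl ?divr_ge0 ?sqr_ge0//.
    by rewrite ltW// phi_gt0.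
- by move=> x bx; rewrite /P divr_ge0 ?ler_pdivrMr ?mul1r; nra.
- move=> x bx; rewrite E subr_ge0 ler_pdivrMr; first by nra.
  by rewrite exprn_gt0// ltr_wpDl ?sqr_ge0.
Qed.

(** The next convergent, [1 / (b + 1 / (b + 2 / b))]. The simpler bound [1 / b] would be too weak:
    in [slope_loss] the terms cancel down to order [b^-4], which takes an upper bound correct up to
    order [b^-5]. *)
Lemma gtail_upper (b : R) : 1 <= b ->
  gtail b <= phi b * ((b ^+ 2 + 2) / (b * (b ^+ 2 + 3))).
Proof.
move=> b1; rewrite -lee_fin -gtail_integral mulrC.
pose P x : R := (x ^+ 2 + 2) / (x * (x ^+ 2 + 3)).
pose dP x : R := - (x ^+ 4 + 3 * x ^+ 2 + 6) / (x * (x ^+ 2 + 3)) ^+ 2.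
have x3 x : x ^+ 2 + 3 != 0 :> R by rewrite gt_eqF// ltr_wpDl ?sqr_ge0.
have x0 x : b <= x -> x != 0 by move=> bx; rewrite gt_eqF//; lra.
have E x : b <= x -> x * P x - dP x = 1 + 6 / (x * (x ^+ 2 + 3)) ^+ 2.
  by move=> bx; rewrite /P /dP; field; rewrite x3 x0.
have dPx (x : R) : b <= x -> is_derive x 1 P (dP x).
  move=> bx; have n0 : x * (x ^+ 2 + 3) != 0 by rewrite mulf_neq0// x0.
  rewrite /P; apply: is_derive_eq; rewrite /dP /GRing.scale/=.
  by field; rewrite x3 x0.
have ddP (x : R) : b <= x -> derivable dP x 1.
  move=> bx; have n0 : (x * (x ^+ 2 + 3)) ^+ 2 != 0.
    by rewrite expf_neq0// mulf_neq0// x0.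
  by rewrite /dP; apply: ex_derive.
rewrite -(@integral_phi_tail P dP b)//.
- apply: ge0_le_integral => //=.
  + by move=> x _; rewrite lee_fin ltW// phi_gt0.
  + by apply/measurable_EFinP; apply: measurable_funTS; exact: measurable_phi.
  + apply/measurable_EFinP; apply: measurable_funM; last first.
      by apply: measurable_funTS; exact: measurable_phi.
    apply: subspace_continuous_measurable_fun => //.
    apply: derivable_within_continuous => x; rewrite in_itv/= andbT => bx.
    apply: derivableB; last exact: ddP.
    by apply: derivableM => //; have [] := dPx _ bx.
  + move=> x; rewrite in_itv/= andbT => bx; rewrite lee_fin E// ler_peMl//.
      by rewrite ltW// phi_gt0.
    by rewrite lerDl divr_ge0 ?sqr_ge0.
- move=> x bx; rewrite /P divr_ge0 ?ler_pdivrMr ?mul1r; nra.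
- by move=> x bx; rewrite E// addr_ge0// divr_ge0 ?sqr_ge0.
Qed.

(** The Laplace transform of a squared Gaussian at [1 / 2], for the exponential Markov bound on
    short Gaussian vectors in [gauss_cap_upper]. *)
Lemma integral_normal_expR :
  (\int[N]_x (expR (- x ^+ 2 / 2))%:E = (Num.sqrt 2)^-1%:E)%E.
Proof.
rewrite ge0_integral_normal; last 2 first.
- apply/measurable_EFinP; apply: measurableT_comp => //.
  by apply: measurable_funM => //; apply: measurableT_comp => //.
- by move=> x; rewrite lee_fin expR_ge0.
under eq_integral.
  move=> x _; rewrite phiE -EFinM mulrCA -expRD.
  rewrite (_ : - x ^+ 2 / 2 + - x ^+ 2 / 2 = - x ^+ 2); last by field.
  rewrite -/(gauss_fun x) EFinM; over.
rewrite ge0_integralZl//=; last 3 first.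
- by apply/measurable_EFinP; exact: measurable_gauss_fun.
- by move=> x _; rewrite lee_fin gauss_fun_ge0.
- by rewrite lee_fin ltW// kappa_gt0.
rewrite integralT_gauss -EFinM /normal_peak expr1n mul1r -mulr_natr.
rewrite sqrtrM ?pi_ge0// invfM mulrAC mulVf ?mul1r//.
by rewrite gt_eqF// sqrtr_gt0 pi_gt0.
Qed.

Lemma gtail0 : gtail 0 = 1 / 2.
Proof.
have := @integral_normal_pdf R 0 1; rewrite ge0_symfun_integralT//.
- rewrite /= -set_itvcy gtail_integral -EFinM => -[] H.
  by move: H; lra.
- exact: normal_pdf_ge0.
- by apply: continuous_normal_pdf; rewrite oner_neq0.
- by move=> x /=; rewrite !phiE sqrrN.
Qed.

Lemma integral_cst_itv (x y c : R) (s : bool) : x <= y ->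
  (\int[mu]_(z in [set` Interval (BLeft x) (BSide s y)]) c%:E =
   (c * (y - x))%:E)%E.
Proof.
move=> xy; rewrite integral_cst//= lebesgue_measure_itv/= lte_fin.
case: ltP => yx; first by rewrite -EFinB -EFinM.
rewrite mule0; have -> : x = y by apply/le_anti; rewrite xy yx.
by rewrite subrr mulr0.
Qed.

(** Write [x - b] as the length of [[b, x]] and exchange the integrals: for fixed [y >= b],
    [x * phi x] integrates over [x >= y] to [phi y]. *)
Lemma integral_normal_sqr_tail (b : R) : 0 <= b ->
  (\int[N]_(x in `[b, +oo[) ((x - b) * x)%:E = (gtail b)%:E)%E.
Proof.
move=> b0.
rewrite integral_normal_itv; last 2 first.
- by apply: measurable_funM => //; exact: measurable_funB.
- by move=> x bx; rewrite mulr_ge0 ?subr_ge0// (le_trans b0).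
pose A : set (measurableTypeR R * measurableTypeR R) :=
  [set p | (b <= p.2) && (p.2 <= p.1)].
have mA : measurable A.
  rewrite (_ : A = [set p | b <= p.2] `&` [set p | p.2 <= p.1]).
    apply: measurableI; rewrite -[X in measurable X]setTI.
      by apply: measurable_fun_le.
    by apply: measurable_fun_le.
  by apply/seteqP; split => p; rewrite /A/=; [move=> /andP[]|move=> [-> ->]].
pose f (p : measurableTypeR R * measurableTypeR R) : \bar R :=
  ((\1_A p) * (p.1 * phi p.1))%:E.
have f0 p : (0 <= f p)%E.
  rewrite /f lee_fin indicE; case: (boolP (p \in A)) => [|_]; last by rewrite mul0r.
  rewrite inE /A/= => /andP[bp pp]; rewrite mul1r mulr_ge0//; last exact: normal_pdf_ge0.
  exact: le_trans (le_trans b0 bp) pp.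
have mf : measurable_fun setT f.
  apply/measurable_EFinP; apply: measurable_funM.
    exact: measurable_indic.
  apply: measurable_funM; first exact: measurable_fst.
  by apply: measurableT_comp => //; exact: measurable_phi.
have := @fubini_tonelli _ _ _ _ _ mu mu f mf f0.
set L := (X in X = _ -> _); set L' := (X in _ = X -> _) => LL'.
transitivity L.
  rewrite [LHS]integral_mkcond; apply: eq_integral => x _.
  rewrite patchE; case: ifPn => [|/negP] /[!inE]/=; rewrite in_itv/= andbT => bx.
    transitivity (\int[mu]_(y in `[b, x]) (x * phi x)%:E)%E.
      rewrite (integral_cst_itv _ _ bx); congr EFin.
      by move: (phi x) => p; ring.
    rewrite integral_mkcond; apply: eq_integral => y _.
    rewrite patchE /f indicE (_ : ((x, y) \in A) = (y \in `[b, x]%classic)).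
      by case: ifPn => _; rewrite ?mul1r ?mul0r.
    by apply/idP/idP => /[!inE]; rewrite /A/= ?in_itv.
  apply/esym; apply: (@integral0_eq _ _ _ mu) => y _.
  have /negbTE nA : (x, y) \notin A.
    apply/negP; rewrite inE /A/= => /andP[yb yx]; apply: bx.
    exact: le_trans yx.
  by rewrite /f indicE nA mul0r.
rewrite LL' /L' -gtail_integral [RHS]integral_mkcond; apply: eq_integral => y _.
rewrite patchE; case: ifPn => [|/negP] /[!inE]/=; rewrite in_itv/= andbT => yb.
  have y0 := le_trans b0 yb.
  rewrite -[RHS](integral_phi_id y0).
  rewrite [RHS]integral_mkcond; apply: eq_integral => x _.
  rewrite patchE /f indicE (_ : ((x, y) \in A) = (x \in `[y, +oo[%classic)).
    by case: ifPn => _; rewrite ?mul1r ?mul0r.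
  by apply/idP/idP => /[!inE]; rewrite /A/= ?in_itv/= yb ?andbT.
apply: (@integral0_eq _ _ _ mu) => x _.
have /negbTE nA : (x, y) \notin A.
  by apply/negP; rewrite inE /A/= => /andP[/yb].
by rewrite /f indicE nA mul0r.
Qed.

Lemma integral_normal_sqr : (\int[N]_x (x ^+ 2)%:E = 1)%E.
Proof.
rewrite ge0_integral_normal; last 2 first.
- by apply/measurable_EFinP; exact: measurable_funX.
- by move=> x; rewrite lee_fin sqr_ge0.
under eq_integral do rewrite -EFinM.
rewrite ge0_symfun_integralT.
- have := integral_normal_sqr_tail (lexx 0); rewrite integral_normal_itv; last 2 first.
  + by apply: measurable_funM => //; exact: measurable_funB.
  + by move=> x x0; rewrite subr0 mulr_ge0.
  under eq_integral do rewrite subr0 -expr2.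
  by rewrite -set_itvcy => ->; rewrite gtail0 -EFinM; congr EFin; field.
- by move=> x; rewrite mulr_ge0 ?sqr_ge0// normal_pdf_ge0.
- move=> x; apply: cvgM; first exact: exprn_continuous.
  by apply: continuous_normal_pdf; rewrite oner_neq0.
- by move=> x /=; rewrite !phiE sqrrN.
Qed.

(** Convexity of [gtail] on the half-line: its derivative [- phi] increases there. Each case
    compares [phi] with the constant [phi t] between [s] and [t]. *)
Lemma gtail_tangent (s t : R) : 0 <= s -> 0 <= t ->
  gtail t - phi t * (s - t) <= gtail s.
Proof.
have mphiE D : measurable_fun D (fun x : measurableTypeR R => (phi x)%:E).
  by apply/measurable_EFinP; apply: measurable_funTS; exact: measurable_phi.
have p0 x : (0 <= (phi x)%:E)%E by rewrite lee_fin normal_pdf_ge0.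
have split x y : x <= y -> ((gtail x)%:E = \int[mu]_(z in `[x, y[) (phi z)%:E + (gtail y)%:E)%E.
  move=> xy; rewrite -!gtail_integral -ge0_integral_setU//=.
  - congr (integral _ _ _); apply/seteqP; split => z /=; rewrite !in_itv/= ?andbT.
      by move=> xz; have [zy|yz] := ltP z y; [left; rewrite xz|right].
    by move=> [/andP[]//|]; exact: le_trans.
  - rewrite disj_set2E; apply/eqP; rewrite -subset0 => z []/=; rewrite !in_itv/=.
    by move=> /andP[_ zy]; rewrite leNgt zy.
move=> s0 t0; rewrite -lee_fin; have [st|/ltW ts] := leP s t.
  rewrite (split _ _ st).
  have -> : (gtail t - phi t * (s - t))%:E =
      ((phi t * (t - s))%:E + (gtail t)%:E)%E by rewrite -EFinD; congr EFin; ring.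
  apply: leeD => //; rewrite -(integral_cst_itv _ true st); apply: ge0_le_integral => //=.
  - by move=> z; rewrite in_itv/= => /andP[sz /ltW zt]; rewrite lee_fin phi_le// (le_trans s0).
rewrite lee_fin lerBlDr -lee_fin EFinD (split _ _ ts) addeC leeD//.
rewrite -(integral_cst_itv _ true ts); apply: ge0_le_integral => //=.
by move=> z; rewrite in_itv/= => /andP[tz _]; rewrite lee_fin phi_le.
Qed.

Lemma gtail_gt0 (b : R) : 1 <= b -> 0 < gtail b.
Proof.
move=> b1; apply: lt_le_trans (gtail_lower b1).
by rewrite mulr_gt0 ?phi_gt0// divr_gt0; nra.
Qed.

Lemma gtail_mul_le (b : R) : 1 <= b -> b * gtail b <= phi b.
Proof.
move=> b1; have b0 : 0 < b by lra.
have b3 : 0 < b ^+ 2 + 3 by nra.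
apply: (@le_trans _ _ (b * (phi b * ((b ^+ 2 + 2) / (b * (b ^+ 2 + 3)))))).
  by rewrite ler_pM2l// gtail_upper.
rewrite (_ : b * _ = phi b * ((b ^+ 2 + 2) / (b ^+ 2 + 3))); last first.
  by field; rewrite !gt_eqF.
rewrite ler_piMr// ?ler_pdivrMr// ?mul1r; last by lra.
by rewrite ltW// phi_gt0.
Qed.

(* With [u] the value at [1/M] of [a y - (y - b)], the slope condition makes
   [a y - (y - b) - u] change sign exactly where [1 - M y] does, and the choice
   of [M] makes [1 - M y] have zero mean over [b, +oo[. *)
Lemma integral_normal_slope (a : R -> R) (b : R) : 1 <= b ->
  (forall y, 0 <= a y) -> (forall x y, x <= y -> a y <= a x + (y - x)) ->
  let M := gtail b / phi b in
  N.-integrable setT (fun y : measurableTypeR R => (a y * (1 - M * y))%:E) ->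
  ((- (M * gtail b - phi b + b * gtail b))%:E <=
   \int[N]_y (a y * (1 - M * y))%:E)%E.
Proof.
move=> b1 a0 aS M inta; have b0 : 0 <= b by lra.
have M0 : 0 < M by rewrite divr_gt0 ?gtail_gt0 ?phi_gt0.
have bM : M * b <= 1.
  by rewrite /M mulrAC ler_pdivrMr ?phi_gt0// mul1r mulrC gtail_mul_le.
have MV : M * M^-1 = 1 by rewrite mulfV// gt_eqF.
pose D : set (measurableTypeR R) := `[b, +oo[%classic.
have Db y : D y -> b <= y by rewrite /D/= in_itv/= andbT.
have mD : measurable D by rewrite /D; exact: measurable_itv.
have int1 : N.-integrable D (fun=> 1%:E).
  apply/integrableP; split => //.
  rewrite (eq_integral (fun=> 1%:E)); last by move=> ? _; rewrite /= normr1.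
  by rewrite integral_cst//= mul1e gtailE ltry.
have intx : N.-integrable D (fun y => y%:E).
  apply/integrableP; split; first exact/measurable_EFinP.
  have -> : (\int[N]_(y in D) `|y%:E| = \int[N]_(y in D) y%:E)%E.
    apply: eq_integral.
    by move=> y /[!inE] /Db yb; rewrite /= ger0_norm//; lra.
  by rewrite integral_normal_id// ltry.
have intxx : N.-integrable D (fun y => ((y - b) * y)%:E).
  apply/integrableP; split.
    apply/measurable_EFinP; apply: measurable_funM => //.
    exact: measurable_funB.
  have -> : (\int[N]_(y in D) `|((y - b) * y)%:E| =
             \int[N]_(y in D) ((y - b) * y)%:E)%E.
    apply: eq_integral.
    by move=> y /[!inE] /Db yb; rewrite /= ger0_norm//; nra.
  by rewrite integral_normal_sqr_tail// ltry.
pose u := a M^-1 - (M^-1 - b).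
pose g (y : measurableTypeR R) : R := (y - b + u) * (1 - M * y).
have gE y : (g y)%:E = ((u - b)%:E * 1%:E + (1 - M * u)%:E * y%:E + (- M)%:E * ((y - b) *
    y)%:E)%E.
  by rewrite -!EFinM -!EFinD; congr EFin; rewrite /g; ring.
have int2 : N.-integrable D (fun y => ((u - b)%:E * 1%:E + (1 - M * u)%:E * y%:E)%E).
  by apply: integrableD => //; apply: integrableZl.
have intg : N.-integrable D (EFin \o g).
  rewrite (_ : EFin \o g = fun y => ((u - b)%:E * 1%:E + (1 - M * u)%:E * y%:E + (- M)%:E *
      ((y - b) * y)%:E)%E).
    by apply: integrableD => //; apply: integrableZl.
  by apply/funext => y; rewrite /= gE.
(* The value is free of [u], because [1 - M * y] integrates over [D] to [gtail b - M * phi b = 0];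
   what remains is the integral of [(y - b) * (1 - M * y)]. *)
have <- : (\int[N]_(y in D) (g y)%:E = (- (M * gtail b - phi b + b * gtail b))%:E)%E.
  under eq_integral do rewrite gE.
  rewrite integralD//=; last exact: integrableZl.
  rewrite integralD//=; [|exact: integrableZl|exact: integrableZl].
  rewrite !integralZl//= integral_cst//= mul1e gtailE integral_normal_id//.
  rewrite integral_normal_sqr_tail// -!EFinM -!EFinD; congr EFin.
  have -> : phi b = gtail b / M by rewrite /M; field; rewrite !gt_eqF ?phi_gt0 ?gtail_gt0.
  by field; rewrite gt_eqF.
rewrite integral_mkcond; apply: le_integral => //.
  by apply/(integrable_mkcond _ _).1.
move=> y _; rewrite patchE; case: ifPn => [/[!inE] /Db yb|].
  rewrite lee_fin -subr_ge0.
  rewrite (_ : _ - _ = (a y - y - (a M^-1 - M^-1)) * (1 - M * y)); last by rewrite /g /u; ring.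
  have [yM|My] := leP y M^-1.
    rewrite mulr_ge0//; last by nra.
    by have := aS _ _ yM; lra.
  rewrite mulr_le0//; last by nra.
  by have := aS _ _ (ltW My); lra.
(* Below [b], [M * b <= 1] makes [1 - M * y] nonnegative, so this part of the integral is bounded
   below by zero. *)
move=> /negP; rewrite inE /D/= in_itv/= andbT => /negP; rewrite -ltNge => yb.
by rewrite lee_fin mulr_ge0//; nra.
Qed.
End gauss1.

(** * Isometries of the Gaussian measure *)

Section lebesgue_affine.
Variable R : realType.
Local Notation mu := (@lebesgue_measure R).

Lemma ge0_integral_shift (c : R) (f : measurableTypeR R -> \bar R) :
  measurable_fun [set: measurableTypeR R] f -> (forall x, (0 <= f x)%E) ->
  (\int[mu]_x f (x + c)%R = \int[mu]_x f x)%E.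
Proof.
move=> mf f0.
pose h (x : measurableTypeR R) : measurableTypeR R := (x + c)%R.
have mh : measurable_fun [set: measurableTypeR R] h by apply: measurable_funD.
transitivity (\int[pushforward mu h]_x f x)%E.
  by rewrite (ge0_integral_pushforward mh)//= preimage_setT.
apply: eq_measure_integral => A mA _; apply/esym.
apply: lebesgue_measure_unique => // _ [[a b]] _ <-.
change (mu `]a, b] = mu (h @^-1` `]a, b]%classic)).
rewrite (_ : h @^-1` _ = `]a - c, b - c]%classic).
  rewrite !lebesgue_measure_itv/= !lte_fin ltrD2r; case: ifP => // _.
  by rewrite -!EFinB; congr EFin; ring.
by apply/seteqP; split => x /=; rewrite /h !in_itv/= ltrBlDr lerBrDr.
Qed.

Lemma ge0_integral_scale (c : R) (f : measurableTypeR R -> \bar R) : 0 < c ->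
  measurable_fun [set: measurableTypeR R] f -> (forall x, (0 <= f x)%E) ->
  (\int[mu]_x f x = c%:E * \int[mu]_x f (c * x)%R)%E.
Proof.
move=> c0 mf f0; have c0' : 0 <= c by exact: ltW.
pose h (x : measurableTypeR R) : measurableTypeR R := (c * x)%R.
have mh : measurable_fun [set: measurableTypeR R] h by apply: measurable_funM.
transitivity (c%:E * \int[pushforward mu h]_x f x)%E; last first.
  by rewrite (ge0_integral_pushforward mh)//= preimage_setT.
rewrite -(@ge0_integral_mscale _ _ _ (pushforward mu h) _ measurableT (NngNum c0'))//.
apply: eq_measure_integral => A mA _.
apply: lebesgue_measure_unique => // _ [[a b]] _ <-.
change (mu `]a, b] = c%:E * mu (h @^-1` `]a, b]%classic))%E.
rewrite (_ : h @^-1` _ = `]a / c, b / c]%classic).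
  rewrite !lebesgue_measure_itv/= !lte_fin ltr_pM2r ?invr_gt0//.
  case: ifP => _; last by rewrite mule0.
  by rewrite -!EFinB -EFinM; congr EFin; field; rewrite gt_eqF.
by apply/seteqP; split => x /=; rewrite /h !in_itv/= ltr_pdivrMr// ler_pdivlMr// mulrC.
Qed.

End lebesgue_affine.

Section isometry.
Variable R : realType.
Local Notation N := (@normal_prob R 0 1).
Local Notation phi := (@normal_pdf R 0 1).
Local Notation mu := (@lebesgue_measure R).
Notation gauss n := (rV_measure (@normal_prob R 0 1) n).

Lemma inner_cons n (p q : measurableTypeR R * 'rV[R]_n) :
  inner (cons_row p) (cons_row q) = p.1 * q.1 + inner p.2 q.2.
Proof.
rewrite /inner big_ord_recl !cons_row0; congr (_ + _).
by apply: eq_bigr => i _; rewrite !cons_rowS.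
Qed.

Definition behead_row n (x : 'rV[R]_n.+1) : 'rV[R]_n :=
  \row_i x ord0 (lift ord0 i).

Lemma behead_cons n p : behead_row (@cons_row R n p) = p.2.
Proof. by apply/rowP => i; rewrite mxE cons_rowS. Qed.

Lemma cons_behead n (x : 'rV[R]_n.+1) : cons_row (x ord0 ord0, behead_row x) = x.
Proof. exact: cons_rowK. Qed.

Lemma cons_row_linear n (k x y : R) (u v : 'rV[R]_n) :
  cons_row (k * x + y, k *: u + v) = k *: cons_row (x, u) + cons_row (y, v).
Proof.
apply/rowP => i; case: (unliftP ord0 i) => [j|] ->; rewrite [RHS]mxE [X in _ = X + _]mxE.
  by rewrite !cons_rowS/= !mxE.
by rewrite !cons_row0.
Qed.

Lemma cons_row00 n : cons_row (0, 0) = 0 :> 'rV[R]_n.+1.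
Proof.
by apply/rowP => i; case: (unliftP ord0 i) => [j|] ->;
  rewrite ?cons_rowS ?cons_row0 !mxE.
Qed.

(** Invariance is stated for nonnegative integrals, a form that composition and lifting pass on
    directly. Rotations of the first two coordinates and their lifts generate enough such maps to
    carry the first axis to any unit vector. *)
Definition gauss_isometry n (T : 'rV[R]_n -> 'rV[R]_n) := [/\ linear T,
  forall x y, inner (T x) (T y) = inner x y,
  measurable_fun [set: 'rV[R]_n] T &
  forall f : 'rV[R]_n -> \bar R, measurable_fun [set: 'rV[R]_n] f ->
    (forall x, (0 <= f x)%E) ->
    (\int[gauss n]_x f (T x) = \int[gauss n]_x f x)%E].

Lemma gauss_isometry_id n : gauss_isometry (@id 'rV[R]_n).
Proof. by split. Qed.

Lemma gauss_isometry_comp n (S T : 'rV[R]_n -> 'rV[R]_n) :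
  gauss_isometry S -> gauss_isometry T -> gauss_isometry (S \o T).
Proof.
move=> [lS iS mS vS] [lT iT mT vT]; split.
- by move=> k x y /=; rewrite lT lS.
- by move=> x y /=; rewrite iS iT.
- exact: measurableT_comp.
- move=> f mf f0.
  by rewrite -(vS f mf f0) -(vT (f \o S) (measurableT_comp mf mS) (fun x => f0 (S x))).
Qed.

Lemma measurable_cons_pair d (T : measurableType d) n (f : T -> R) (g : T -> 'rV[R]_n) :
  measurable_fun [set: T] f -> measurable_fun [set: T] g ->
  measurable_fun [set: T] (fun t => cons_row (f t, g t)).
Proof.
move=> mf mg.
apply: (@measurableT_comp _ _ _ _ _ _ _ _ (fun t => (f t : measurableTypeR R, g t))
    (@measurable_cons_row R n)).
exact: measurable_fun_pair.
Qed.

Lemma gauss_isometry_lift n (T : 'rV[R]_n -> 'rV[R]_n) : gauss_isometry T ->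
  gauss_isometry (fun x : 'rV[R]_n.+1 => cons_row (x ord0 ord0, T (behead_row x))).
Proof.
move=> [lT iT mT vT]; split.
- move=> k x y; rewrite -cons_row_linear -lT; congr cons_row.
  rewrite !mxE; congr (_, T _).
  by apply/rowP => i; rewrite !mxE.
- move=> x y; rewrite inner_cons/= iT.
  by rewrite -[in RHS](cons_behead x) -[in RHS](cons_behead y) inner_cons.
- apply: measurable_cons_pair; first exact: measurable_coord.
  by apply: measurableT_comp => //; exact: measurable_behead_row.
- move=> f mf f0.
  have mS : measurable_fun setT (fun x : 'rV[R]_n.+1 => cons_row (x ord0 ord0, T
      (behead_row x))).
    apply: measurable_cons_pair; first exact: measurable_coord.
    by apply: measurableT_comp => //; exact: measurable_behead_row.
  rewrite (ge0_integral_rVS _ (measurableT_comp mf mS) (fun x => f0 _)).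
  rewrite (ge0_integral_rVS _ mf f0).
  apply: eq_integral => x _.
  rewrite -(vT (fun y => f (cons_row (x, y))))//.
    by apply: eq_integral => y _; rewrite /= cons_row0 behead_cons.
  by apply: measurableT_comp => //; exact: measurable_cons_pair.
Qed.

(* A rotation is a composition of three shears. *)
Let ge0_integral_rot_lebesgue (c s : R) (F : measurableTypeR R * measurableTypeR R -> \bar R) :
  c ^+ 2 + s ^+ 2 = 1 -> 0 <= c -> measurable_fun setT F -> (forall p, (0 <= F p)%E) ->
  (\int[mu]_x \int[mu]_y F (c * x - s * y, s * x + c * y)%R =
   \int[mu]_x \int[mu]_y F (x, y))%E.
Proof.
move=> cs c0 mF F0.
have mpair (g h : measurableTypeR R * measurableTypeR R -> measurableTypeR R) :
    measurable_fun setT g -> measurable_fun setT h ->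
    measurable_fun setT (fun p => F (g p, h p)).
  move=> mg mh; apply: (@measurableT_comp _ _ _ _ _ _ F _ (fun p => (g p, h p))) => //.
  exact: measurable_fun_pair.
have c1 : 1 + c != 0 by rewrite gt_eqF//; lra.
(* For the angle [theta] with cosine [c] and sine [s], this is [- tan (theta / 2)]; [0 <= c] keeps
   the denominator away from zero. *)
pose al := - s / (1 + c).
have E (x y : R) : (c * x - s * y, s * x + c * y) =
    (x + al * y + al * (y + s * (x + al * y)), y + s * (x + al * y)).
  have H : al * s = c - 1.
    by rewrite /al; apply: (mulIf c1); rewrite mulrAC divfK//; move: cs; nra.
  have H2 : al * (1 + c) = - s by rewrite /al divfK.
  have -> : y + s * (x + al * y) = s * x + c * y.
    by rewrite (_ : _ + _ = y + s * x + (al * s) * y); [rewrite H; ring|ring].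
  congr pair.
  rewrite (_ : _ + _ = x + (al * s) * x + (al * (1 + c)) * y); last by ring.
  by rewrite H H2; ring.
under eq_integral do under eq_integral do rewrite E.
pose G1 (p : measurableTypeR R * measurableTypeR R) := F (p.1 + al * p.2, p.2).
pose G2 (p : measurableTypeR R * measurableTypeR R) := G1 (p.1, p.2 + s * p.1).
have mG1 : measurable_fun setT G1.
  apply: mpair; last exact: measurable_snd.
  apply: measurable_funD; first exact: measurable_fst.
  by apply: measurable_funM => //; exact: measurable_snd.
have mG2 : measurable_fun setT G2.
  apply: mpair.
    apply: measurable_funD; first exact: measurable_fst.
    apply: measurable_funM => //.
    apply: measurable_funD; first exact: measurable_snd.
    by apply: measurable_funM => //; exact: measurable_fst.
  apply: measurable_funD; first exact: measurable_snd.
  by apply: measurable_funM => //; exact: measurable_fst.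
have shear1 (G : measurableTypeR R * measurableTypeR R -> \bar R) :
    measurable_fun setT G -> (forall p, (0 <= G p)%E) ->
    (\int[mu]_x \int[mu]_y G (x + al * y, y)%R = \int[mu]_x \int[mu]_y G (x, y))%E.
  move=> mG G0.
  have mGs : measurable_fun setT (fun p : measurableTypeR R * measurableTypeR R => G (p.1 +
      al * p.2, p.2)).
    apply: (@measurableT_comp _ _ _ _ _ _ G _ (fun p : measurableTypeR R * measurableTypeR
        R => (p.1 + al * p.2 : measurableTypeR R, p.2))) => //.
    apply: measurable_fun_pair; last exact: measurable_snd.
    apply: measurable_funD; first exact: measurable_fst.
    by apply: measurable_funM => //; exact: measurable_snd.
  rewrite (fubini_tonelli (fun p : measurableTypeR R * measurableTypeR R => G (p.1 + al *
      p.2, p.2)) mGs (fun p => G0 _)).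
  rewrite (fubini_tonelli G mG G0); apply: eq_integral => y _ /=.
  apply: (@ge0_integral_shift _ _ (fun x => G (x, y))) => //.
  exact: measurableT_comp.
have G20 p : (0 <= G2 p)%E by exact: F0.
have G10 p : (0 <= G1 p)%E by exact: F0.
transitivity (\int[mu]_x \int[mu]_y G2 (x + al * y, y)%R)%E.
  by [].
rewrite (shear1 G2 mG2 G20); transitivity (\int[mu]_x \int[mu]_y G1 (x, y))%E; last exact:
    (shear1 F mF F0).
apply: eq_integral => x _.
apply: (@ge0_integral_shift _ (s * x) (fun y => G1 (x, y))) => //.
exact: measurableT_comp.
Qed.

(** The product density is a function of [x ^+ 2 + y ^+ 2], which the rotation preserves, so the
    Lebesgue case applies to [F] times the density. *)
Lemma ge0_integral_rot (c s : R) (F : measurableTypeR R * measurableTypeR R -> \bar R) :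
  c ^+ 2 + s ^+ 2 = 1 -> 0 <= c -> measurable_fun setT F -> (forall p, (0 <= F p)%E) ->
  (\int[N]_x \int[N]_y F (c * x - s * y, s * x + c * y)%R =
   \int[N]_x \int[N]_y F (x, y))%E.
Proof.
move=> cs c0 mF F0.
have density (H : measurableTypeR R * measurableTypeR R -> \bar R) :
    measurable_fun setT H -> (forall p, (0 <= H p)%E) ->
    (\int[N]_x \int[N]_y H (x, y) =
     \int[mu]_x \int[mu]_y (H (x, y) * (phi x * phi y)%:E))%E.
  move=> mH H0; rewrite ge0_integral_normal; last 2 first.
  - exact: (measurable_fun_fubini_tonelli_F H).
  - by move=> x; apply: integral_ge0.
  apply: eq_integral => x _; rewrite ge0_integral_normal//; last exact: measurableT_comp.
  rewrite -ge0_integralZr//=; last 3 first.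
  - apply: emeasurable_funM; first exact: measurableT_comp.
    by apply/measurable_EFinP; exact: measurable_phi.
  - by move=> y _; rewrite mule_ge0// lee_fin normal_pdf_ge0.
  - by rewrite lee_fin normal_pdf_ge0.
  by apply: eq_integral => y _; rewrite -muleA -EFinM mulrC.
pose T (p : measurableTypeR R * measurableTypeR R) : measurableTypeR R * measurableTypeR R :=
  (c * p.1 - s * p.2, s * p.1 + c * p.2).
have mT : measurable_fun setT T.
  apply: measurable_fun_pair.
    by apply: measurable_funB; apply: measurable_funM.
  by apply: measurable_funD; apply: measurable_funM.
rewrite (density (F \o T)) /=; [|exact: measurableT_comp|by move=> p; exact: F0].
rewrite (density F mF F0).
pose F' (p : measurableTypeR R * measurableTypeR R) := (F p * (phi p.1 * phi p.2)%:E)%E.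
have mF' : measurable_fun setT F'.
  apply: emeasurable_funM => //; apply/measurable_EFinP.
  by apply: measurable_funM; apply: measurableT_comp => //; exact: measurable_phi.
have F'0 p : (0 <= F' p)%E.
  by rewrite /F' mule_ge0// lee_fin mulr_ge0// normal_pdf_ge0.
rewrite -[RHS](ge0_integral_rot_lebesgue cs c0 mF' F'0).
apply: eq_integral => x _; apply: eq_integral => y _; congr (_ * _%:E)%E.
rewrite !phiE mulrACA -expRD [RHS]mulrACA -expRD; congr (_ * expR _).
transitivity (- ((c ^+ 2 + s ^+ 2) * (x ^+ 2 + y ^+ 2)) / 2).
  by rewrite cs; field.
by rewrite /=; field.
Qed.

Definition rot n (c s : R) (x : 'rV[R]_n.+2) : 'rV[R]_n.+2 :=
  let a := x ord0 ord0 in let b := x ord0 (lift ord0 ord0) in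
  cons_row (c * a - s * b, cons_row (s * a + c * b, behead_row (behead_row x))).

Lemma rot_cons n c s (a b : R) (z : 'rV[R]_n) :
  rot c s (cons_row (a, cons_row (b, z))) =
  cons_row (c * a - s * b, cons_row (s * a + c * b, z)).
Proof. by rewrite /rot !cons_rowS !cons_row0/= !behead_cons. Qed.

Lemma gauss_isometry_rot n (c s : R) : c ^+ 2 + s ^+ 2 = 1 -> 0 <= c ->
  gauss_isometry (@rot n c s).
Proof.
move=> cs c0.
have mrot : measurable_fun setT (@rot n c s).
  apply: measurable_cons_pair.
    by apply: measurable_funB; apply: measurable_funM => //; exact: measurable_coord.
  apply: measurable_cons_pair.
    by apply: measurable_funD; apply: measurable_funM => //; exact: measurable_coord.
  by apply: measurableT_comp => //; exact: measurable_behead_row.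
split => //.
- move=> k x y; rewrite /rot -!cons_row_linear; congr cons_row; rewrite !mxE; congr pair.
    by ring.
  congr cons_row; congr pair; first by ring.
  by apply/rowP => i; rewrite !mxE.
- move=> x y; rewrite /rot !inner_cons/=.
  rewrite -[in RHS](cons_behead x) -[in RHS](cons_behead y) inner_cons/=.
  rewrite -[in RHS](cons_behead (behead_row x)) -[in RHS](cons_behead (behead_row y))
      inner_cons/=.
  rewrite !mxE [LHS]addrA [RHS]addrA; congr (_ + _).
  set a := x _ _; set b := x _ _; set a' := y _ _; set b' := y _ _.
  transitivity ((c ^+ 2 + s ^+ 2) * (a * a' + b * b')); first by ring.
  by rewrite cs mul1r.
- move=> f mf f0; rewrite (ge0_integral_rVS _ (measurableT_comp mf mrot) (fun x => f0 _)).
  rewrite (ge0_integral_rVS _ mf f0).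
  pose F (p : measurableTypeR R * measurableTypeR R) :=
    (\int[gauss n]_z f (cons_row (p.1, cons_row (p.2, z))))%E.
  have mF : measurable_fun setT F.
    apply: (measurable_fun_fubini_tonelli_F (fun q : (measurableTypeR R * measurableTypeR
        R) * 'rV[R]_n => f (cons_row (q.1.1, cons_row (q.1.2, q.2))))) => //.
    apply: (@measurableT_comp _ _ _ _ _ _ f) => //; apply: measurable_cons_pair.
      by apply: measurableT_comp => //; exact: measurable_fst.
    apply: measurable_cons_pair => //.
    by apply: measurableT_comp => //; exact: measurable_snd.
  have F0 p : (0 <= F p)%E by apply: integral_ge0.
  transitivity (\int[N]_x \int[N]_y F (c * x - s * y, s * x + c * y)%R)%E.
    apply: eq_integral => x _; rewrite ge0_integral_rVS.
    - by apply: eq_integral => y _; apply: eq_integral => z _; rewrite /= rot_cons.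
    - apply: (measurableT_comp mf); apply: (measurableT_comp mrot).
      exact: measurable_cons_pair.
    - by move=> y; exact: f0.
  rewrite (ge0_integral_rot cs c0 mF F0); apply: eq_integral => x _.
  rewrite ge0_integral_rVS; first by [].
    by apply: (measurableT_comp mf); exact: measurable_cons_pair.
  by move=> y; exact: f0.
Qed.

(** Induction on the dimension: [T] first aligns the tail with its own first axis, then a rotation
    of the first two coordinates merges head and tail. The length [r] carries a sign, chosen through
    [sg] so that the rotation has a nonnegative cosine. *)
Let exists_isometry n (v : 'rV[R]_n.+1) : exists r T,
  [/\ gauss_isometry T, r ^+ 2 = inner v v & T (cons_row (r, 0)) = v].
Proof.
elim: n v => [|n IH] v.
  exists (v ord0 ord0), id; split; first exact: gauss_isometry_id.
    by rewrite /inner big_ord_recl big_ord0 addr0 expr2.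
  by rewrite -[RHS](cons_behead v); congr (cons_row (_, _)); apply/rowP => -[].
have [r [T [gT rE Tr]]] := IH (behead_row v).
have vv : inner v v = v ord0 ord0 ^+ 2 + r ^+ 2.
  by rewrite -(cons_behead v) inner_cons/= rE cons_row0 expr2.
have [v0|v0] := eqVneq (inner v v) 0.
  exists 0, id; split; [exact: gauss_isometry_id|by rewrite v0 expr0n|].
  have [a0 r0] : v ord0 ord0 = 0 /\ r = 0.
    move: v0; rewrite vv => /eqP; rewrite paddr_eq0 ?sqr_ge0// !sqrf_eq0.
    by move=> /andP[/eqP ? /eqP ?].
  rewrite -(cons_behead v) a0 -Tr r0; congr (cons_row (_, _)).
  rewrite cons_row00.
  by case: gT => /(_ (-1) 0 0) + _ _ _; rewrite scaler0 addr0 scaleN1r addNr.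
have vpos : 0 < inner v v by rewrite lt_neqAle eq_sym v0 vv addr_ge0 ?sqr_ge0.
pose sg : R := if 0 <= v ord0 ord0 then 1 else -1.
have sg2 : sg ^+ 2 = 1 by rewrite /sg; case: ifP => _; rewrite ?sqrrN expr1n.
pose q := sg * Num.sqrt (inner v v).
have q2 : q ^+ 2 = inner v v by rewrite /q exprMn sg2 mul1r sqr_sqrtr// ltW.
have q0 : q != 0 by rewrite -sqrf_eq0 q2 gt_eqF.
pose c := v ord0 ord0 / q; pose s := r / q.
have cs : c ^+ 2 + s ^+ 2 = 1.
  by rewrite /c /s !exprMn -mulrDl -vv exprVn q2 mulfV.
have c0 : 0 <= c.
  rewrite /c /q /sg; case: ifPn => [a0|]; first by rewrite mul1r divr_ge0// sqrtr_ge0.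
  rewrite -ltNge mulN1r => a0; rewrite invrN mulrN -mulNr divr_ge0 ?sqrtr_ge0//.
  by rewrite oppr_ge0 ltW.
exists q, ((fun x : 'rV[R]_n.+2 => cons_row (x ord0 ord0, T (behead_row x))) \o @rot n c s).
split => //.
  by apply: gauss_isometry_comp; [exact: gauss_isometry_lift|exact: gauss_isometry_rot].
rewrite /= /rot !cons_rowS !cons_row0/= !behead_cons/=.
rewrite -[RHS](cons_behead v) mxE; congr (cons_row (_, _)).
  by rewrite mulr0 subr0 /c divfK.
rewrite -Tr; congr (T (cons_row (_, _))).
  by rewrite mulr0 addr0 /s divfK.
by apply/rowP => i; rewrite !mxE.
Qed.

(** If the signed length is [-1], a half-turn of the first two coordinates, obtained as two
    quarter-turns, repairs it; hence dimension at least two. *)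
Lemma gauss_isometry_unit n (v : 'rV[R]_n.+2) : inner v v = 1 ->
  exists2 T, gauss_isometry T & T (cons_row (1, 0)) = v.
Proof.
move=> v1; have [r [T [gT rE Tr]]] := exists_isometry v.
move: rE; rewrite v1 => /eqP; rewrite sqrf_eq1 => /orP[] /eqP rE.
  by exists T => //; rewrite -rE.
exists (T \o (@rot n 0 1 \o @rot n 0 1)).
  have g01 : gauss_isometry (@rot n 0 1) by apply: gauss_isometry_rot => //; ring.
  by apply: gauss_isometry_comp => //; exact: gauss_isometry_comp.
have E a : cons_row (a, 0) = cons_row (a, cons_row (0, 0)) :> 'rV[R]_n.+2.
  by rewrite cons_row00.
rewrite -[RHS]Tr rE !E -[LHS]/(T (rot 0 1 (rot 0 1 _))).
rewrite (rot_cons 0 1 1 0) rot_cons.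
by congr (T (cons_row (_, cons_row (_, _)))); ring.
Qed.

End isometry.

(** * Caps as Gaussian cones *)

Section cap_volume.
Variable R : realType.
Local Notation N := (@normal_prob R 0 1).
Local Notation phi := (@normal_pdf R 0 1).
Local Notation kappa := (@normal_peak R 1).
Local Notation mu := (@lebesgue_measure R).
Local Notation gauss n := (rV_measure (@normal_prob R 0 1) n).
Local Notation leb n := (rV_measure (@lebesgue_measure R) n).
Local Notation norm2 x := (Num.sqrt (inner x x)).

Lemma inner_ge0 n (x : 'rV[R]_n) : 0 <= inner x x.
Proof. by apply: sumr_ge0 => i _; rewrite -expr2 sqr_ge0. Qed.

Lemma inner_eq0 n (x : 'rV[R]_n) : (inner x x == 0) = (x == 0).
Proof.
apply/eqP/eqP => [/eqP|->]; last by apply: big1 => i _; rewrite !mxE mul0r.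
rewrite /inner psumr_eq0; last by move=> i _; rewrite -expr2 sqr_ge0.
move=> /allP H; apply/rowP => i; rewrite mxE.
by have := H i (mem_index_enum i); rewrite /= mulf_eq0 orbb => /eqP.
Qed.

Lemma innerZ n (a b : R) (x y : 'rV[R]_n) :
  inner (a *: x) (b *: y) = a * b * inner x y.
Proof. by rewrite /inner mulr_sumr; apply: eq_bigr => i _; rewrite !mxE; ring. Qed.

Lemma measurable_inner d (T : measurableType d) n (f g : T -> 'rV[R]_n) :
  measurable_fun [set: T] f -> measurable_fun [set: T] g ->
  measurable_fun [set: T] (fun t => inner (f t) (g t)).
Proof.
move=> mf mg; apply: measurable_sum => i; apply: measurable_funM.
  exact: (measurableT_comp (measurable_coord i) mf).
exact: (measurableT_comp (measurable_coord i) mg).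
Qed.

Lemma measurable_norm2 d (T : measurableType d) n (f : T -> 'rV[R]_n) :
  measurable_fun [set: T] f -> measurable_fun [set: T] (fun t => norm2 (f t)).
Proof.
move=> mf; apply: (@measurableT_comp _ _ _ _ _ _ (@Num.sqrt R)).
  by apply: continuous_measurable_fun; exact: sqrt_continuous.
exact: measurable_inner.
Qed.

Lemma measurable_preimage d1 d2 (T1 : measurableType d1) (T2 : measurableType d2)
  (f : T1 -> T2) (A : set T2) : measurable_fun [set: T1] f -> measurable A ->
  measurable [set x | A (f x)].
Proof. by move=> mf mA; rewrite -[X in measurable X]setTI; exact: mf. Qed.

Lemma measure_indic d (T : measurableType d) (m : {measure set T -> \bar R})
    (A : set T) : measurable A -> m A = (\int[m]_x (\1_A x)%:E)%E.
Proof. by move=> mA; rewrite integral_indic// setIT. Qed.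

Lemma rV_measure_scale n (c : R) (A : set 'rV[R]_n) : 0 < c -> measurable A ->
  (leb n A = (c ^+ n)%:E * leb n [set x | A (c *: x)])%E.
Proof.
move=> c0; elim: n A => [|n IH] A mA.
  rewrite expr0 mul1e /=; congr (dirac _ _); apply/seteqP.
  by split => x /=; rewrite (_ : c *: x = x)//; apply/rowP => -[].
have mcons (x : R) : measurable_fun setT (fun y : 'rV[R]_n => cons_row (x, y)).
  exact: measurable_cons_pair.
have mF : measurable_fun [set: measurableTypeR R] (fun x => leb n [set y | A (cons_row (x,
    y))]).
  have := @measurable_fun_xsection _ _ _ _ _ (leb n) (@cons_row R n @^-1` A).
  have mcA : measurable (@cons_row R n @^-1` A).
    by apply: measurable_preimage => //; exact: measurable_cons_row.
  move=> /(_ mcA); congr measurable_fun; apply/funext => x /=; congr (leb n _).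
  by apply/seteqP; split => y; rewrite /xsection /= inE.
rewrite rV_measureS (ge0_integral_scale c0 mF)//.
rewrite rV_measureS exprS EFinM -muleA; congr (_ * _)%E.
rewrite -ge0_integralZl//; last 2 first.
- have mcs : measurable_fun setT (fun x : 'rV[R]_n.+1 => c *: x).
    apply: measurable_rVP => i; under eq_fun do rewrite mxE.
    by apply: measurable_funM => //; exact: measurable_coord.
  have := @measurable_fun_xsection _ _ _ _ _ (leb n) (@cons_row R n @^-1` [set x | A (c *: x)]).
  have mcA : measurable (@cons_row R n @^-1` [set x | A (c *: x)]).
    apply: measurable_preimage; first exact: measurable_cons_row.
    exact: measurable_preimage.
  move=> /(_ mcA); congr measurable_fun; apply/funext => x /=; congr (leb n _).
  by apply/seteqP; split => y; rewrite /xsection /= inE.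
- by rewrite lee_fin exprn_ge0// ltW.
apply: eq_integral => x _; rewrite IH; last exact: measurable_preimage.
have cZ y : cons_row (c * x, c *: y) = c *: cons_row (x, y).
  by have := cons_row_linear c x 0 y 0; rewrite !addr0 cons_row00 addr0.
by congr (_ * leb n _)%E; apply/seteqP; split => y /=; rewrite cZ.
Qed.

Lemma integral_rV0 (m : {sigma_finite_measure set (measurableTypeR R) -> \bar R})
    (f : 'rV[R]_0 -> \bar R) :
  measurable_fun setT f -> (\int[rV_measure m 0]_x f x = f 0%R)%E.
Proof. by move=> mf; rewrite /= integral_dirac ?diracT ?mul1e. Qed.

Lemma gauss_density n (f : 'rV[R]_n -> \bar R) : measurable_fun setT f ->
  (forall x, (0 <= f x)%E) ->
  (\int[gauss n]_x f x =
   \int[leb n]_x (f x * (kappa ^+ n * expR (- inner x x / 2))%:E))%E.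
Proof.
have mw m : measurable_fun [set: 'rV[R]_m] (fun x => (kappa ^+ m * expR (- inner x x / 2))%:E).
  apply/measurable_EFinP; apply: measurable_funM => //.
  apply: measurableT_comp => //; apply: measurable_funM => //.
  by apply: measurableT_comp => //; exact: measurable_inner.
elim: n f => [|n IH] f mf f0.
  rewrite (integral_rV0 _ mf) (integral_rV0 _ (emeasurable_funM mf (mw 0%N))).
  by rewrite /inner big_ord0 oppr0 mul0r expR0 expr0 mul1r mule1.
have w0 m (x : 'rV[R]_m) : (0 <= (kappa ^+ m * expR (- inner x x / 2))%:E)%E.
  by rewrite lee_fin mulr_ge0 ?expR_ge0// exprn_ge0// normal_peak_ge0.
have mcons (x : R) : measurable_fun setT (fun y : 'rV[R]_n => cons_row (x, y)).
  exact: measurable_cons_pair.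
rewrite (ge0_integral_rVS _ mf f0).
have mfw := emeasurable_funM mf (mw n.+1).
have fw0 x : (0 <= f x * (kappa ^+ n.+1 * expR (- inner x x / 2))%:E)%E.
  by rewrite mule_ge0.
rewrite (ge0_integral_rVS _ mfw fw0).
rewrite ge0_integral_normal; last 2 first.
- apply: (measurable_fun_fubini_tonelli_F (f \o @cons_row R n)).
  - by apply: measurableT_comp => //; exact: measurable_cons_row.
  - by move=> p; exact: f0.
- by move=> x; apply: integral_ge0 => y _.
apply: eq_integral => x _; rewrite IH//; last exact: measurableT_comp.
rewrite -ge0_integralZr//=; last 3 first.
- exact: emeasurable_funM (measurableT_comp mf (mcons x)) (mw n).
- by move=> y _; rewrite mule_ge0.
- by rewrite lee_fin normal_pdf_ge0.
apply: eq_integral => y _; rewrite -muleA -EFinM; congr (_ * _%:E)%E.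
rewrite phiE inner_cons/= (exprS kappa n) mulrACA [kappa ^+ n * _]mulrC -expRD; congr (_ *
    expR _).
by field.
Qed.

Definition is_cone n (D : set 'rV[R]_n) :=
  forall (s : R) x, 0 < s -> D x -> D (s *: x).

Lemma norm2_le n (x : 'rV[R]_n) (s : R) : 0 <= s -> (norm2 x <= s) = (inner x x <= s ^+ 2).
Proof.
by move=> s0; rewrite -[in RHS](sqr_sqrtr (inner_ge0 x)) ler_sqr// nnegrE sqrtr_ge0.
Qed.

(* Layer cake on [expR (- |x| ^ 2 / 2)]: the part of a cone in the ball of radius
   [s] is [s] times its part in the unit ball. *)
Lemma gauss_cone n : exists c : \bar R, (0 <= c)%E /\
  forall D : set 'rV[R]_n, measurable D -> is_cone D ->
  (kappa%:E * gauss n D = c * leb n [set x | D x /\ (inner x x <= 1)%R])%E.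
Proof.
pose k : R := kappa ^+ n.
have k0 : 0 <= k by rewrite exprn_ge0// normal_peak_ge0.
pose g (s : measurableTypeR R) : \bar R := (k * (\1_(`]0, +oo[%classic) s * (s * phi s) * s
    ^+ n))%:E.
exists (\int[mu]_s g s)%E.
have g0 s : (0 <= g s)%E.
  rewrite /g lee_fin indicE; case: (boolP (s \in _)) => [|_]; last by rewrite !mul0r mulr0.
  rewrite inE/= in_itv/= andbT => /ltW s0.
  by rewrite !mulr_ge0// ?exprn_ge0// normal_pdf_ge0.
have mg : measurable_fun setT g.
  apply/measurable_EFinP; apply: measurable_funM => //; apply: measurable_funM.
    apply: measurable_funM; first exact: measurable_indic.
    by apply: measurable_funM => //; exact: measurable_phi.
  exact: measurable_funX.
split=> [|D mD cD]; first exact: integral_ge0.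
have mw : measurable_fun [set: 'rV[R]_n] (fun x => phi (norm2 x)).
  apply: (measurableT_comp (@measurable_phi R)); exact: measurable_norm2.
(* The extra factor [kappa] turns the density into [k * phi (norm2 x)], and [phi (norm2 x)] is the
   integral of [s * phi s] over [s >= norm2 x]. *)
transitivity (\int[leb n]_x ((k * \1_D x * phi (norm2 x))%:E))%E.
  rewrite (measure_indic (gauss n) mD).
  rewrite -ge0_integralZl//=; last 2 first.
  - by apply/measurable_EFinP; exact: measurable_indic.
  - by rewrite lee_fin normal_peak_ge0.
  rewrite (gauss_density (f := fun x => (kappa%:E * (\1_D x)%:E)%E)); last 2 first.
  - by apply: emeasurable_funM => //; apply/measurable_EFinP; exact: measurable_indic.
  - by move=> x; rewrite mule_ge0// lee_fin ?normal_peak_ge0.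
  apply: eq_integral => x _; rewrite -!EFinM; congr EFin.
  by rewrite phiE sqr_sqrtr ?inner_ge0// /k; ring.
pose B : set ('rV[R]_n * measurableTypeR R) := [set p | norm2 p.1 <= p.2].
have mB : measurable B.
  rewrite -[X in measurable X]setTI; apply: measurable_fun_le => //.
  exact: measurable_norm2.
pose F (p : 'rV[R]_n * measurableTypeR R) : \bar R :=
  (k * \1_D p.1 * (\1_B p * (p.2 * phi p.2)))%:E.
have F0 p : (0 <= F p)%E.
  rewrite /F lee_fin; apply: mulr_ge0; first exact: mulr_ge0.
  rewrite indicE; case: (boolP (p \in B)) => [|_]; last by rewrite mul0r.
  rewrite inE /B/= => H; rewrite mul1r mulr_ge0 ?normal_pdf_ge0//.
  exact: le_trans (sqrtr_ge0 _) H.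
have mF : measurable_fun setT F.
  apply/measurable_EFinP; apply: measurable_funM.
    by apply: measurable_funM => //; apply: measurableT_comp.
  apply: measurable_funM; first exact: measurable_indic.
  by apply: measurable_funM => //; apply: measurableT_comp => //; exact: measurable_phi.
transitivity (\int[leb n]_x \int[mu]_s F (x, s))%E.
  apply: eq_integral => x _.
  transitivity ((k * \1_D x)%:E * \int[mu]_(s in `[norm2 x, +oo[) (s * phi s)%:E)%E.
    by rewrite integral_phi_id ?sqrtr_ge0.
  rewrite integral_mkcond -ge0_integralZl//; last 3 first.
  - apply/(measurable_restrictT _ _).1 => //; apply: measurable_funTS.
    by apply/measurable_EFinP; apply: measurable_funM => //; exact: measurable_phi.
  - move=> s _; rewrite patchE; case: ifPn => // /[!inE]/=.
    rewrite in_itv/= andbT => xs; rewrite lee_fin mulr_ge0 ?normal_pdf_ge0//.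
    exact: le_trans (sqrtr_ge0 _) xs.
  - by rewrite lee_fin mulr_ge0.
  apply: eq_integral => s _; rewrite patchE /F (indicE _ B).
  rewrite (_ : ((x, s) \in B) = (s \in `[norm2 x, +oo[%classic)).
    by case: ifPn => _; rewrite ?mul1r ?mul0r ?mulr0 ?mule0.
  by apply/idP/idP => /[!inE]; rewrite /B/= ?in_itv/= andbT.
rewrite (fubini_tonelli F mF F0).
set L := leb n _; rewrite -ge0_integralZr//; last exact: measure_ge0.
apply: eq_integral => s _; rewrite /g indicE.
have [s0|s0] := ltP 0 s; last first.
  rewrite memNset/=; last by rewrite in_itv/= andbT ltNge s0.
  rewrite !mul0r mulr0 mul0e; apply: integral0_eq => x _; rewrite /F/= (indicE _ B).
  case: (boolP ((x, s) \in B)) => [|_]; last by rewrite mul0r mulr0.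
  rewrite inE /B/= => xs; have -> : s = 0.
    by apply/le_anti; rewrite s0 (le_trans (sqrtr_ge0 _) xs).
  by rewrite mul0r !mulr0.
rewrite mem_set/=; last by rewrite in_itv/= andbT.
pose A := [set x : 'rV[R]_n | D x /\ norm2 x <= s].
have mA : measurable A.
  apply: measurableI => //; rewrite -[X in measurable X]setTI.
  by apply: measurable_fun_le => //; exact: measurable_norm2.
transitivity ((k * (s * phi s))%:E * leb n A)%E; last first.
  rewrite (rV_measure_scale s0 mA) mul1r !EFinM !muleA; congr (_ * leb n _)%E.
  apply/seteqP; split => x /=; rewrite /A/= norm2_le ?(ltW s0)// innerZ -expr2.
    rewrite -[leRHS]mulr1 ler_pM2l ?exprn_gt0// => -[Dx x1]; split => //.
    by rewrite -(scalerK (lt0r_neq0 s0) x); apply: cD => //; rewrite invr_gt0.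
  move=> [Dx x1]; split; first exact: cD.
  by rewrite -[leRHS]mulr1 ler_pM2l ?exprn_gt0.
rewrite (measure_indic (leb n) mA).
rewrite -ge0_integralZl//; last 2 first.
- by apply/measurable_EFinP; exact: measurable_indic.
- by rewrite lee_fin !mulr_ge0 ?normal_pdf_ge0// ltW.
apply: eq_integral => x _; rewrite /F -EFinM; congr EFin => /=.
have -> : \1_A x = \1_D x * \1_B (x, s) :> R.
  rewrite !indicE -natrM mulnb; congr (_%:R); congr nat_of_bool.
  by apply/idP/andP => [/[!inE] -[? ?]|[/[!inE] ? ?]]; rewrite ?inE.
by move: (phi s) => p; ring.
Qed.

Lemma gauss_setT n : gauss n setT = 1%E.
Proof. by apply: rV_measure_setT; exact: probability_setT. Qed.

Lemma integral_gauss_cst n (c : R) : (\int[gauss n]_x c%:E = c%:E)%E.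
Proof. by rewrite integral_cst//= gauss_setT mule1. Qed.

Lemma integral_gauss_sqr n : (\int[gauss n]_x (inner x x)%:E = n%:R%:E)%E.
Proof.
elim: n => [|n IH].
  rewrite /= integral_dirac//; first by rewrite diracT mul1e /inner big_ord0.
  by apply/measurable_EFinP; exact: measurable_inner.
rewrite ge0_integral_rVS; last 2 first.
- by apply/measurable_EFinP; exact: measurable_inner.
- by move=> x; rewrite lee_fin inner_ge0.
transitivity (\int[N]_x ((x ^+ 2)%:E + n%:R%:E))%E.
  apply: eq_integral => x _; rewrite -IH -[X in (X + _)%E](integral_gauss_cst n).
  rewrite -ge0_integralD//; last 3 first.
  - by move=> y _; rewrite lee_fin sqr_ge0.
  - by move=> y _; rewrite lee_fin inner_ge0.
  - by apply/measurable_EFinP; exact: measurable_inner.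
  by apply: eq_integral => y _; rewrite inner_cons/= -EFinD expr2.
rewrite ge0_integralD//; last 2 first.
- by move=> y _; rewrite lee_fin sqr_ge0.
- by apply/measurable_EFinP; exact: measurable_funX.
rewrite integral_normal_sqr integral_cst//= probability_setT mule1 -EFinD.
by rewrite -natr1 addrC.
Qed.

Lemma integral_gauss_expR n :
  (\int[gauss n]_x (expR (- inner x x / 2))%:E = ((Num.sqrt 2)^-1 ^+ n)%:E)%E.
Proof.
have me m : measurable_fun [set: 'rV[R]_m] (fun x => (expR (- inner x x / 2))%:E).
  apply/measurable_EFinP; apply: measurableT_comp => //; apply: measurable_funM => //.
  by apply: measurableT_comp => //; exact: measurable_inner.
elim: n => [|n IH].
  by rewrite (integral_rV0 _ (me 0%N)) /inner big_ord0 oppr0 mul0r expR0.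
rewrite (ge0_integral_rVS _ (me _)); last by move=> x; rewrite lee_fin expR_ge0.
transitivity (\int[N]_x ((expR (- x ^+ 2 / 2))%:E * ((Num.sqrt 2)^-1 ^+ n)%:E))%E.
  apply: eq_integral => x _; rewrite -IH -ge0_integralZl//; last exact: me.
  apply: eq_integral => y _; rewrite inner_cons/= -EFinM -expRD; congr (expR _)%:E.
  by field.
rewrite ge0_integralZr//; last first.
  apply/measurable_EFinP; apply: measurableT_comp => //; apply: measurable_funM => //.
  by apply: measurableT_comp => //; exact: measurable_funX.
by rewrite integral_normal_expR -EFinM exprS.
Qed.

Lemma measurable_neq0 n : measurable [set x : 'rV[R]_n | x != 0].
Proof.
rewrite (_ : [set x | _] = ~` [set x | inner x x <= 0]).
  apply: measurableC; rewrite -[X in measurable X]setTI.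
  by apply: measurable_fun_le => //; exact: measurable_inner.
by apply/seteqP; split => x /=; rewrite -inner_eq0 eq_le inner_ge0 andbT => /negP.
Qed.

Lemma measurable_cap_cone n (v : 'rV[R]_n) (r : R) :
  measurable [set x : 'rV[R]_n | x != 0 /\ r * norm2 x <= inner x v].
Proof.
apply: measurableI; first exact: measurable_neq0.
rewrite -[X in measurable X]setTI; apply: measurable_fun_le => //.
  by apply: measurable_funM => //; exact: measurable_norm2.
exact: measurable_inner.
Qed.

Lemma gauss_neq0 n : gauss n.+1 [set x | x != 0] = 1%E.
Proof.
have m0 := @measurable_neq0 n.+1.
apply/eqP; rewrite eq_le -[X in (_ <= X)%E && _](gauss_setT n.+1).
rewrite le_measure ?inE//=.
rewrite rV_measureS.
have N0 : N (~` [set 0]) = 1%E.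
  rewrite probability_setC// [X in (_ - X)%E](_ : _ = 0%E) ?sube0//.
  exact: integral_set1.
rewrite -N0.
have mC0 : measurable (~` [set 0] : set (measurableTypeR R)) by exact: measurableC.
rewrite (measure_indic (N) mC0).
apply: ge0_le_integral => //=.
- by apply/measurable_EFinP/measurable_indic; exact: measurableC.
- have := @measurable_fun_xsection _ _ _ _ _ (gauss n) (@cons_row R n @^-1` [set x | x != 0]).
  have mcA : measurable (@cons_row R n @^-1` [set x | x != 0]).
    by apply: measurable_preimage => //; exact: measurable_cons_row.
  move=> /(_ mcA); congr measurable_fun; apply/funext => x /=; congr (gauss n _).
  by apply/seteqP; split => y; rewrite /xsection /= inE.
- move=> x _; rewrite indicE; case: (boolP (x \in [set~ 0%R])) => [|_]; last exact: measure_ge0.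
  rewrite inE/= => x0.
  rewrite -(gauss_setT n) le_measure// ?inE//.
    apply: (measurable_preimage _ m0); exact: measurable_cons_pair.
  move=> y _ /=; apply/eqP => /rowP/(_ ord0); rewrite cons_row0 mxE/=.
  by move=> x1; apply: x0; rewrite x1.
Qed.

Lemma norm2_gt0 n (x : 'rV[R]_n) : x != 0 -> 0 < norm2 x.
Proof. by move=> x0; rewrite sqrtr_gt0 lt_neqAle inner_ge0 andbT eq_sym inner_eq0. Qed.

Lemma norm2Z n (a : R) (x : 'rV[R]_n) : 0 <= a -> norm2 (a *: x) = a * norm2 x.
Proof. by move=> a0; rewrite innerZ sqrtrM ?mulr_ge0// -expr2 sqrtr_sqr ger0_norm. Qed.

Lemma innerZl n (a : R) (x y : 'rV[R]_n) : inner (a *: x) y = a * inner x y.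
Proof. by rewrite -[y in LHS]scale1r innerZ mulr1. Qed.

Lemma ball_coneE n (P : 'rV[R]_n -> Prop) : is_cone [set x | P x] ->
  ball_cone [set x | sphere x /\ P x] =
  [set x | (x != 0 /\ P x) /\ inner x x <= 1].
Proof.
move=> cP; apply/seteqP; split => [_ [t /=] /andP[t0 t1] [x [/= sx Px] <-]|x /= [[x0 Px] x1]].
  have xx : inner x x = 1.
    by rewrite -(sqr_sqrtr (inner_ge0 x)); move: sx; rewrite /sphere/= => ->; rewrite expr1n.
  split; last by rewrite innerZ xx mulr1 mulr_ile1// ltW.
  split; last exact: cP.
  rewrite scaler_eq0 negb_or gt_eqF//=.
  by rewrite -inner_eq0 xx oner_neq0.
have x0' := norm2_gt0 x0.
exists (norm2 x) => /=; first by rewrite x0' -[leRHS]sqrtr1 ler_wsqrtr.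
exists ((norm2 x)^-1 *: x); last by rewrite scalerA mulfV ?scale1r// gt_eqF.
split; last by apply: cP => //; rewrite invr_gt0.
by rewrite /sphere/= norm2Z ?invr_ge0 ?ltW// mulVf// gt_eqF.
Qed.

(** A positive finite product rules out infinite factors, since zero times infinity is zero. This
    yields a finite volume for the ball without computing it. *)
Lemma mule_real (k : R) (c L : \bar R) : 0 < k -> (0 <= c)%E -> (0 <= L)%E ->
  (k%:E = c * L)%E -> exists c' L' : R, [/\ c = c'%:E, L = L'%:E & k = c' * L'].
Proof.
case: c L => [c| |] [L| |] // k0; rewrite ?lee_fin => c0 L0.
- by rewrite -EFinM => -[kE]; exists c, L.
- have [->|cn] := eqVneq c 0; first by rewrite mul0e => -[kE]; move: k0; rewrite kE ltxx.
  by rewrite gt0_muley// lte_fin lt_neqAle eq_sym cn.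
- have [->|Ln] := eqVneq L 0; first by rewrite mule0 => -[kE]; move: k0; rewrite kE ltxx.
  by rewrite gt0_mulye// lte_fin lt_neqAle eq_sym Ln.
Qed.

(** [gauss_cone] holds with one constant for all cones. Applied to the cone of the cap and to the
    complement of the origin, which has full Gaussian measure, it lets the constant cancel in the
    ratio. *)
Lemma normalized_volume_cap n (v : 'rV[R]_n.+1) (theta : R) :
  (normalized_volume (cap v theta))%:E =
  gauss n.+1 [set x | x != 0 /\ cos theta * norm2 x <= inner x v].
Proof.
set r := cos theta; set D := [set x | _].
have [c [c0 cE]] := gauss_cone n.+1.
have mD : measurable D := measurable_cap_cone v r.
have cone0 : is_cone [set x : 'rV[R]_n.+1 | x != 0].
  by move=> s x s0 /= x0; rewrite scaler_eq0 negb_or gt_eqF.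
have conev : is_cone [set x : 'rV[R]_n.+1 | r * norm2 x <= inner x v].
  move=> s x s0 /= H; rewrite (norm2Z _ (ltW s0)) innerZl.
  have -> : r * (s * norm2 x) = s * (r * norm2 x) by ring.
  by rewrite ler_pM2l.
have coneD : is_cone D by move=> s x s0 /= [x0 H]; split; [exact: cone0|exact: conev].
have m0 := @measurable_neq0 n.+1.
have := cE _ mD coneD; have := cE _ m0 cone0; rewrite gauss_neq0 mule1.
rewrite /normalized_volume !lebesgue_rVE.
rewrite (_ : ball_cone (cap v theta) = [set x | D x /\ inner x x <= 1]); last first.
  rewrite (_ : cap v theta = [set x | sphere x /\ r * norm2 x <= inner x v]).
    exact: (@ball_coneE n.+1 (fun x => r * norm2 x <= inner x v) conev).
  by apply/seteqP; split => x /= [sx]; have := sx; rewrite /sphere/= => ->; rewrite mulr1.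
rewrite (_ : ball_cone (@sphere R n.+1) = [set x | x != 0 /\ inner x x <= 1]); last first.
  have := @ball_coneE n.+1 (fun=> True) (fun _ _ _ _ => I).
  rewrite (_ : [set x | sphere x /\ True] = @sphere R n.+1).
    by move=> ->; apply/seteqP; split => x /= [] // [].
  by apply/seteqP; split => x /=; [move=> []|].
set LB := leb _ _; set LD := leb _ _ => EB ED.
have kap := normal_peak_gt0 (oner_neq0 R).
have LB0 : (0 <= LB)%E by exact: measure_ge0.
have mDB : measurable [set x | D x /\ inner x x <= 1].
  apply: measurableI => //; rewrite -[X in measurable X]setTI.
  by apply: measurable_fun_le => //; exact: measurable_inner.
have m0B : measurable [set x : 'rV[R]_n.+1 | x != 0 /\ inner x x <= 1].
  apply: measurableI => //; rewrite -[X in measurable X]setTI.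
  by apply: measurable_fun_le => //; exact: measurable_inner.
have LDB : (LD <= LB)%E.
  by rewrite le_measure ?inE// => x /= [[x0 _] x1].
have LD0 : (0 <= LD)%E by exact: measure_ge0.
have gD1 : (gauss n.+1 D <= 1)%E by rewrite -(gauss_setT n.+1) le_measure ?inE.
have gD0 : (0 <= gauss n.+1 D)%E by exact: measure_ge0.
have [c' [LB' [cE' LBE kE]]] := mule_real kap c0 LB0 EB.
have LDf : LD \is a fin_num.
  by rewrite ge0_fin_numE//; apply: le_lt_trans LDB _; rewrite LBE ltry.
have gDf : gauss n.+1 D \is a fin_num.
  by rewrite ge0_fin_numE//; apply: le_lt_trans gD1 _; rewrite ltry.
move: ED; rewrite cE' LBE -(fineK LDf) -(fineK gDf) -!EFinM => -[E]; congr EFin.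
have LB'0 : LB' != 0 by apply/eqP => H; move: kE; rewrite H mulr0; lra.
have c'0 : c' != 0 by apply/eqP => H; move: kE; rewrite H mul0r; lra.
have kap0 : kappa != 0 by rewrite gt_eqF.
rewrite /=; apply: (mulfI kap0); apply: (etrans _ (esym E)).
by rewrite {1}kE; field.
Qed.

Lemma gauss_coord n (A : set (measurableTypeR R)) : measurable A ->
  gauss n.+1 [set x | A (x ord0 ord0)] = N A.
Proof.
move=> mA; rewrite rV_measureS.
rewrite (measure_indic (N) mA).
apply: eq_integral => x _; rewrite indicE; case: (boolP (x \in A)) => [|/negP] /[!inE] Ax.
  rewrite -[RHS](gauss_setT n); congr (gauss n _).
  by apply/seteqP; split => y //= _; rewrite cons_row0.
rewrite -[RHS](measure0 (gauss n)); congr (gauss n _).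
by apply/seteqP; split => y //=; rewrite cons_row0.
Qed.

Lemma normal_open_tail (b : R) : N `]b, +oo[%classic = (gtail b)%:E.
Proof.
rewrite -gtail_integral; apply: integral_itv_obnd_cbnd.
by apply/measurable_EFinP; apply: measurable_funTS; exact: measurable_phi.
Qed.

Definition polar_cap n (r : R) : set 'rV[R]_n.+1 :=
  [set x | x != 0 /\ r * norm2 x <= x ord0 ord0].

Lemma inner_e0 n (x : 'rV[R]_n.+1) : inner x (cons_row (1, 0)) = x ord0 ord0.
Proof.
rewrite -{1}(cons_behead x) inner_cons/= mulr1 /inner big1 ?addr0// => i _.
by rewrite [X in _ * X]mxE mulr0.
Qed.

Lemma polar_capE n (r : R) : polar_cap r =
  [set x : 'rV[R]_n.+1 | x != 0 /\ r * norm2 x <= inner x (cons_row (1, 0))].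
Proof. by apply/seteqP; split => x; rewrite /polar_cap/= inner_e0. Qed.

Lemma measurable_polar_cap n (r : R) : measurable (@polar_cap n r).
Proof. by rewrite polar_capE; exact: measurable_cap_cone. Qed.

Lemma gauss_cap n (v : 'rV[R]_n.+2) (r : R) : inner v v = 1 ->
  gauss n.+2 [set x | x != 0 /\ r * norm2 x <= inner x v] =
  gauss n.+2 (polar_cap r).
Proof.
move=> v1; have [T [lT iT mT vT] Tv] := gauss_isometry_unit v1.
set D := [set x | _]; have mD : measurable D := measurable_cap_cone v r.
have mP := @measurable_polar_cap n.+1 r.
rewrite (measure_indic (gauss n.+2) mD).
rewrite (measure_indic (gauss n.+2) mP).
rewrite -(vT (fun x => (\1_D x)%:E))//; last first.
  by apply/measurable_EFinP; exact: measurable_indic.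
apply: eq_integral => x _; rewrite !indicE; congr (_%:R%:E); congr nat_of_bool.
have E : D (T x) = polar_cap r x.
  by rewrite polar_capE /D/= -Tv !iT -!inner_eq0 iT.
by apply/idP/idP => /[!inE]; rewrite E.
Qed.

(** Such a cone contains an open half-space. Caps of volume below one half therefore have positive
    cosine. *)
Lemma gauss_cap_half n (r : R) : r <= 0 -> ((1 / 2)%:E <= gauss n.+1 (polar_cap r))%E.
Proof.
move=> r0; rewrite -gtail0 -normal_open_tail -(gauss_coord n); last exact: measurable_itv.
apply: le_measure; rewrite ?inE.
- apply: measurable_preimage; last exact: measurable_itv.
  exact: measurable_coord.
- exact: measurable_polar_cap.
move=> x /=; rewrite in_itv/= andbT => x0; split.
  by apply/eqP => xE; move: x0; rewrite xE mxE ltxx.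
by apply: le_trans (ltW x0); rewrite mulr_le0_ge0// sqrtr_ge0.
Qed.

(* Given its other coordinates [y], a vector is in the cap as soon as its first
   coordinate exceeds [q |y|]; bounding the convex [gtail] below by its tangent at
   [s] leaves only the second moment of [|y|] to be integrated. *)
Lemma gauss_cap_lower n (r s : R) : 0 < r -> r < 1 -> 0 < s ->
  s ^+ 2 * (1 - r ^+ 2) = r ^+ 2 * n%:R ->
  ((gtail s)%:E <= gauss n.+1 (polar_cap r))%E.
Proof.
move=> r0 r1 s0 sE; have r2 : 0 < 1 - r ^+ 2 by nra.
pose q := r / Num.sqrt (1 - r ^+ 2).
have q0 : 0 <= q by rewrite divr_ge0 ?sqrtr_ge0// ltW.
have qE : q ^+ 2 * (1 - r ^+ 2) = r ^+ 2.
  by rewrite /q exprMn exprVn sqr_sqrtr ?ltW// divfK// gt_eqF.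
have mP := @measurable_polar_cap n r.
pose f (x : 'rV[R]_n.+1) : \bar R := (\1_(polar_cap r) x)%:E.
have mf : measurable_fun setT f by apply/measurable_EFinP; exact: measurable_indic.
have f0 x : (0 <= f x)%E by rewrite lee_fin.
pose G (y : 'rV[R]_n) : \bar R := (\int[N]_x f (cons_row (x, y)))%E.
have mG : measurable_fun setT G.
  apply: (measurable_fun_fubini_tonelli_G (f \o @cons_row R n)).
    by apply: measurableT_comp => //; exact: measurable_cons_row.
  by move=> p; exact: f0.
have G0 y : (0 <= G y)%E by apply: integral_ge0.
have PE : gauss n.+1 (polar_cap r) = (\int[gauss n]_y G y)%E.
  rewrite /G -(ge0_integral_rVS_swap _ mf f0); exact: measure_indic.
have Glower y : ((gtail (q * norm2 y))%:E <= G y)%E.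
  rewrite -normal_open_tail.
  rewrite (measure_indic (N) (measurable_itv _)).
  apply: ge0_le_integral => //.
  - by apply/measurable_EFinP; exact: measurable_indic.
  - by apply: (measurableT_comp mf); apply: measurable_cons_pair.
  move=> x _; rewrite /f lee_fin !indicE ler_nat.
  case: (boolP (x \in _)) => [|//]; rewrite inE/= in_itv/= andbT => qx.
  have x0 : 0 < x by apply: le_lt_trans qx; rewrite mulr_ge0 ?sqrtr_ge0.
  rewrite mem_set//; split.
    by apply/eqP => /rowP/(_ ord0); rewrite cons_row0 mxE/= => xE; move: x0; rewrite xE ltxx.
  rewrite cons_row0/= -ler_sqr ?nnegrE ?mulr_ge0 ?sqrtr_ge0// ?(ltW r0)// ?(ltW x0)//.
  rewrite exprMn sqr_sqrtr ?inner_ge0// inner_cons/=.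
  have : (q * norm2 y) ^+ 2 <= x ^+ 2.
    by rewrite ler_sqr ?nnegrE ?mulr_ge0 ?sqrtr_ge0// ltW.
  rewrite exprMn sqr_sqrtr ?inner_ge0// => /(ler_wpM2r (ltW r2)).
  rewrite mulrAC qE -subr_ge0 => H; rewrite -subr_ge0.
  by rewrite (_ : _ - _ = x ^+ 2 * (1 - r ^+ 2) - r ^+ 2 * inner y y)//; ring.
(* The linear term of the tangent is made quadratic by [q z <= (q z) ^+ 2 / (2 s) + s / 2], an
   equality at [q z = s]. As [s] is the root mean square of [q |y|], the two corrections cancel
   after integration. *)
pose c := phi s * q ^+ 2 / (2 * s).
have c0 : 0 <= c.
  apply: divr_ge0; first by rewrite mulr_ge0 ?normal_pdf_ge0 ?sqr_ge0.
  by rewrite mulr_ge0// ltW.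
have Gc y : ((gtail s + phi s * s / 2)%:E <= G y + (c * inner y y)%:E)%E.
  apply: le_trans (leeD2r _ (Glower y)); rewrite -EFinD lee_fin.
  have := gtail_tangent (mulr_ge0 q0 (sqrtr_ge0 (inner y y))) (ltW s0).
  set z := Num.sqrt (inner y y); have -> : inner y y = z ^+ 2 by rewrite sqr_sqrtr ?inner_ge0.
  have p0 := phi_gt0 s; rewrite /c; move: (gtail _) (gtail _) (phi s) p0 => g1 g2 p p0 H.
  have -> : p * q ^+ 2 / (2 * s) * z ^+ 2 = p * ((q * z - s) ^+ 2 / (2 * s) + q * z - s / 2).
    by field; rewrite gt_eqF.
  have : 0 <= p * ((q * z - s) ^+ 2 / (2 * s)).
    apply: mulr_ge0; first exact: ltW.
    by apply: divr_ge0; [exact: sqr_ge0|rewrite mulr_ge0// ltW].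
  lra.
have : ((gtail s + phi s * s / 2)%:E <= \int[gauss n]_y (G y + (c * inner y y)%:E))%E.
  rewrite -[leLHS](integral_gauss_cst n); apply: ge0_le_integral => //.
  - move=> y _; rewrite lee_fin addr_ge0 ?gtail_ge0// divr_ge0// mulr_ge0 ?normal_pdf_ge0//.
    exact: ltW.
  - apply: emeasurable_funD => //; apply/measurable_EFinP; apply: measurable_funM => //.
    exact: measurable_inner.
rewrite ge0_integralD//; last 2 first.
- by move=> y _; rewrite lee_fin mulr_ge0// inner_ge0.
- apply/measurable_EFinP; apply: measurable_funM => //; exact: measurable_inner.
under [X in (_ <= _ + X)%E -> _]eq_integral do rewrite EFinM.
rewrite ge0_integralZl//; last 2 first.
- by apply/measurable_EFinP; exact: measurable_inner.
- by move=> y _; rewrite lee_fin inner_ge0.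
rewrite integral_gauss_sqr -EFinM -PE.
have -> : c * n%:R = phi s * s / 2.
  have sq : s ^+ 2 = q ^+ 2 * n%:R.
    by apply: (mulIf (lt0r_neq0 r2)); rewrite sE [RHS]mulrAC qE.
  rewrite /c (_ : _ * n%:R = phi s * (q ^+ 2 * n%:R) / (2 * s)); last first.
    by move: (phi s) => p; field; rewrite gt_eqF.
  by rewrite -sq; move: (phi s) => p; field; rewrite gt_eqF.
by rewrite EFinD leeD2rE.
Qed.

(** Either [|x| ^ 2 <= n / 4], where [n] is the dimension, an event bounded by Markov's inequality
    for [expR (- |x| ^ 2 / 2)], or the first coordinate is at least [r * sqrt n / 2 = t / 2]. *)
Lemma gauss_cap_upper n (r t : R) : 0 < r -> t = r * Num.sqrt n.+1%:R -> 2 <= t ->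
  (gauss n.+1 (polar_cap r) <=
   (phi (t / 2) + expR (n.+1%:R / 8) * (Num.sqrt 2)^-1 ^+ n.+1)%:E)%E.
Proof.
move=> r0 tE t2.
pose A : set 'rV[R]_n.+1 := [set x | (`[t / 2, +oo[%classic : set (measurableTypeR R)) (x
    ord0 ord0)].
pose B : set 'rV[R]_n.+1 := [set x | inner x x <= n.+1%:R / 4].
have mA : measurable A.
  apply: measurable_preimage; first exact: measurable_coord.
  exact: measurable_itv.
have mB : measurable B.
  rewrite -[X in measurable X]setTI; apply: measurable_fun_le => //.
  exact: measurable_inner.
apply: (@le_trans _ _ (gauss n.+1 A + gauss n.+1 B)%E).
  apply: (@le_trans _ _ (gauss n.+1 (A `|` B))); last exact: measureU2.
  apply: le_measure; rewrite ?inE; [exact: measurable_polar_cap|exact: measurableU|].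
  move=> x [x0 rx]; have [xB|xB] := leP (inner x x) (n.+1%:R / 4); [by right|left].
  rewrite /A/= in_itv/= andbT; apply: le_trans rx; rewrite tE -mulrA ler_pM2l//.
  rewrite (_ : Num.sqrt n.+1%:R / 2 = Num.sqrt (n.+1%:R / 4)).
    by rewrite ler_wsqrtr// ltW.
  rewrite sqrtrM ?ler0n// (_ : 4^-1 = (2^-1) ^+ 2); last by field.
  by rewrite sqrtr_sqr ger0_norm.
rewrite EFinD; apply: leeD.
  rewrite gauss_coord ?gtailE ?lee_fin; last exact: measurable_itv.
  have t1 : 1 <= t / 2 by rewrite ler_pdivlMr// mul1r.
  by apply: le_trans (gtail_mul_le t1); rewrite ler_peMl// gtail_ge0.
have me : measurable_fun [set: 'rV[R]_n.+1] (fun x => (expR (- inner x x / 2))%:E).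
  apply/measurable_EFinP; apply: measurableT_comp => //; apply: measurable_funM => //.
  by apply: measurableT_comp => //; exact: measurable_inner.
rewrite EFinM -integral_gauss_expR -ge0_integralZl//.
rewrite (measure_indic (gauss n.+1) mB).
apply: ge0_le_integral => //.
- by apply/measurable_EFinP; exact: measurable_indic.
- exact: emeasurable_funM.
move=> x _; rewrite -EFinM lee_fin -expRD indicE.
case: (boolP (x \in B)) => [|_]; last by rewrite expR_ge0.
rewrite inE /B/= => xB; rewrite -[leLHS]expR0 ler_expR; lra.
Qed.
End cap_volume.

(** * The penalized covering map *)

Section inner_product.
Variables (R : realType) (n : nat).
Implicit Types x y z : 'rV[R]_n.

Lemma innerC x y : inner x y = inner y x.
Proof. by apply: eq_bigr => i _; rewrite mulrC. Qed.

Lemma innerDl x y z : inner (x + y) z = inner x z + inner y z.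
Proof. by rewrite -big_split; apply: eq_bigr => i _; rewrite mxE mulrDl. Qed.

Lemma innerDr x y z : inner z (x + y) = inner z x + inner z y.
Proof. by rewrite ![inner z _]innerC innerDl. Qed.

Lemma innerZr (a : R) x y : inner x (a *: y) = a * inner x y.
Proof. by rewrite innerC innerZl innerC. Qed.

Lemma innerNl x y : inner (- x) y = - inner x y.
Proof. by rewrite -scaleN1r innerZl mulN1r. Qed.

Lemma innerNr x y : inner x (- y) = - inner x y.
Proof. by rewrite innerC innerNl innerC. Qed.

Lemma inner_suml m (f : 'I_m -> 'rV[R]_n) z :
  inner (\sum_j f j) z = \sum_j inner (f j) z.
Proof.
elim/big_rec2: _ => [|j a b _ <-]; last by rewrite innerDl.
by rewrite /inner big1// => i _; rewrite mxE mul0r.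
Qed.

Lemma inner_sumr m (f : 'I_m -> 'rV[R]_n) z :
  inner z (\sum_j f j) = \sum_j inner z (f j).
Proof. by rewrite innerC inner_suml; apply: eq_bigr => j _; rewrite innerC. Qed.

Lemma inner_sqr_le x y : inner x y ^+ 2 <= inner x x * inner y y.
Proof.
have [y0|y0] := eqVneq (inner y y) 0.
  have -> : y = 0 by apply/eqP; rewrite -inner_eq0 y0.
  by rewrite -(scale0r y) innerZr innerZ !mul0r expr0n mulr0.
have yp : 0 < inner y y by rewrite lt_neqAle eq_sym y0 inner_ge0.
have := inner_ge0 (inner y y *: x + (- inner x y) *: y).
rewrite !innerDl !innerDr !innerZ [inner y x]innerC => H.
rewrite -subr_ge0 -(pmulr_rge0 _ yp); move: H; congr (_ <= _); ring.
Qed.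

Lemma inner_le x y : inner x y <= Num.sqrt (inner x x) * Num.sqrt (inner y y).
Proof.
rewrite -sqrtrM ?inner_ge0//; apply: le_trans (ler_norm _) _.
by rewrite -sqrtr_sqr ler_wsqrtr// inner_sqr_le.
Qed.

End inner_product.

Section penalized.
Variables (R : realType) (n m : nat) (v : 'I_m -> 'rV[R]_n) (eps c : R).
Hypothesis v1 : forall j, inner (v j) (v j) = 1.
Hypotheses (eps0 : 0 < eps) (c0 : 0 < c).
Local Notation norm2 x := (Num.sqrt (inner x x)).

Definition ramp j (w : 'rV[R]_n) : R := c * Num.max (inner (v j) w - 1) 0.

(** The gradient of [eps |w| ^ 2 / 2 + (c / 2) \sum_j ((<v_j, w> - 1)_+) ^ 2]; solving [penal w = x]
    maximizes [<x, w>] minus this penalty. *)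
Definition penal (w : 'rV[R]_n) : 'rV[R]_n :=
  eps *: w + \sum_j ramp j w *: v j.

Lemma ramp_ge0 j w : 0 <= ramp j w.
Proof. by apply: mulr_ge0; [exact: ltW|rewrite le_max lexx orbT]. Qed.

Lemma ramp_mono j w w' :
  0 <= (ramp j w - ramp j w') * inner (v j) (w - w').
Proof.
rewrite innerDr innerNr /ramp -mulrBr -mulrA pmulr_rge0//.
move: (inner _ w) (inner _ w') => p q.
by have := sqr_ge0 (p - q); have [P|P] := leP (p - 1) 0; have [Q|Q] := leP (q - 1) 0; nra.
Qed.

Lemma ramp_lip j w w' :
  (ramp j w - ramp j w') ^+ 2 <= c ^+ 2 * inner (w - w') (w - w').
Proof.
apply: (@le_trans _ _ (c ^+ 2 * inner (v j) (w - w') ^+ 2)).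
  rewrite innerDr innerNr /ramp -mulrBr exprMn ler_pM2l ?exprn_gt0//.
  move: (inner _ w) (inner _ w') => p q.
  by have := sqr_ge0 (p - q); have [P|P] := leP (p - 1) 0; have [Q|Q] := leP (q - 1) 0; nra.
rewrite ler_pM2l ?exprn_gt0// (le_trans (inner_sqr_le _ _))//.
by rewrite v1 mul1r.
Qed.

Lemma penal_sub w w' : penal w - penal w' =
  eps *: (w - w') + \sum_j (ramp j w - ramp j w') *: v j.
Proof.
rewrite /penal scalerBr opprD addrACA -sumrB; congr (_ + _).
by apply: eq_bigr => j _; rewrite scalerBl.
Qed.

Lemma penal_mono w w' :
  eps * inner (w - w') (w - w') <= inner (penal w - penal w') (w - w').
Proof.
rewrite penal_sub [leRHS]innerDl innerZl lerDl inner_suml; apply: sumr_ge0 => j _.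
by rewrite innerZl ramp_mono.
Qed.

Lemma inner_add_le (x y : 'rV[R]_n) :
  inner (x + y) (x + y) <= 2 * inner x x + 2 * inner y y.
Proof.
have := inner_ge0 (x - y); rewrite !innerDl !innerDr !innerNl !innerNr [inner y x]innerC.
lra.
Qed.

Lemma penal_lip : exists2 B, 0 <= B & forall w w',
  inner (penal w - penal w') (penal w - penal w') <= B * inner (w - w') (w - w').
Proof.
have [B B0 HB] : exists2 B, 0 <= B & forall w w',
    let s := \sum_j (ramp j w - ramp j w') *: v j in
    inner s s <= B * inner (w - w') (w - w').
  (* Only the existence of some [B] matters; adding one pole at a time needs nothing beyond
     [inner_add_le]. *)
  rewrite /=; elim: (index_enum _) => [|j s [B B0 IH]].
    by exists 0 => // w w'; rewrite big_nil mul0r (_ : inner _ _ = 0)//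
      /inner big1// => i _; rewrite mxE mul0r.
  exists (2 * c ^+ 2 + 2 * B); first by rewrite addr_ge0// mulr_ge0// sqr_ge0.
  move=> w w'; rewrite big_cons (le_trans (inner_add_le _ _))//.
  rewrite innerZ v1 mulr1 -expr2; have := IH w w'; have := ramp_lip j w w'; lra.
exists (2 * eps ^+ 2 + 2 * B); first by rewrite addr_ge0// mulr_ge0// sqr_ge0.
move=> w w'; rewrite penal_sub (le_trans (inner_add_le _ _))// innerZ -expr2.
have := HB w w'; rewrite /=; lra.
Qed.

(** Strong monotonicity and the Lipschitz bound give the squared ratio [1 - 2 eta eps + eta ^ 2 B],
    at most [1 - eta eps] for the chosen step. The term [eps ^+ 2] in the denominator of [eta] keeps
    that number nonnegative. *)
Lemma penal_contraction : exists eta rho : R, [/\ 0 < eta, 0 <= rho < 1 &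
  forall x w w', let g u := u + eta *: (x - penal u) in
    inner (g w - g w') (g w - g w') <= rho ^+ 2 * inner (w - w') (w - w')].
Proof.
have [B B0 HB] := penal_lip.
pose eta := eps / (B + eps ^+ 2).
have Be : 0 < B + eps ^+ 2 by rewrite ltr_wpDl// exprn_gt0.
have eta0 : 0 < eta by rewrite divr_gt0.
pose q := 1 - eta * eps.
have etaE : eta * (B + eps ^+ 2) = eps by rewrite /eta divfK// gt_eqF.
have etaB : eta ^+ 2 * B <= eta * eps.
  by rewrite -[in leRHS]etaE expr2 -mulrA ler_pM2l// ler_pM2l// lerDl sqr_ge0.
have ee0 : 0 < eta * eps by rewrite mulr_gt0.
have q1 : q < 1 by rewrite /q; lra.
have q0 : 0 <= q.
  by rewrite subr_ge0 /eta mulrAC ler_pdivrMr// mul1r -expr2 lerDr.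
exists eta, (Num.sqrt q); split => //.
  by rewrite sqrtr_ge0 -sqrtr1 ltr_sqrt.
move=> x w w' /=; rewrite sqr_sqrtr//.
rewrite (_ : w + eta *: (x - penal w) - (w' + eta *: (x - penal w')) = (w - w') + (- eta)
    *: (penal w - penal w')); last first.
    by apply/rowP => i; rewrite !mxE; ring.
have := penal_mono w w'; have := HB w w'.
move: (w - w') (penal w - penal w') => d e.
rewrite !innerDl !innerDr !innerZl !innerZr [inner d e]innerC.
move: (inner_ge0 d); move: (inner d d) (inner e d) (inner e e) => I P S I0 HS HP.
have e2 : 0 <= eta ^+ 2 by rewrite sqr_ge0.
have := ler_wpM2l e2 HS; have := ler_wpM2l (ltW eta0) HP.
have := ler_wpM2r I0 etaB.
rewrite /q; lra.
Qed.

Lemma cvg_big_sum (I : Type) (s : seq I) (f : I -> nat -> R) (l : I -> R) :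
  (forall i, f i k @[k --> \oo] --> l i) ->
  (\sum_(i <- s) f i k) @[k --> \oo] --> \sum_(i <- s) l i.
Proof.
move=> fl; elim: s => [|i s IH].
  by under eq_fun do rewrite big_nil; rewrite big_nil; exact: cvg_cst.
by under eq_fun do rewrite big_cons; rewrite big_cons; apply: cvgD.
Qed.

Lemma coord_le (u : 'rV[R]_n) i : `|u ord0 i| <= norm2 u.
Proof.
rewrite -sqrtr_sqr ler_wsqrtr// /inner (bigD1 i)//= expr2 lerDl sumr_ge0// => j _.
by rewrite -expr2 sqr_ge0.
Qed.

(** Banach's iteration is run explicitly from [0]: the inverse is a coordinatewise limit of iterates
    that are measurable in [x] by induction, so measurability comes along with existence. *)
Lemma penal_inverse : exists2 w : 'rV[R]_n -> 'rV[R]_n,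
  measurable_fun [set: 'rV[R]_n] w & forall x, penal (w x) = x.
Proof.
have [eta [rho [eta0 /andP[rho0 rho1] ctr]]] := penal_contraction.
pose g x u := u + eta *: (x - penal u).
pose it x k : 'rV[R]_n := iter k (g x) 0.
pose D x : R := inner (it x 1%N - it x 0%N) (it x 1%N - it x 0%N).
have step x k : inner (it x k.+1 - it x k) (it x k.+1 - it x k) <= (rho ^+ k) ^+ 2 * D x.
  elim: k => [|k IH]; first by rewrite expr0 expr1n mul1r.
  apply: le_trans (ctr x (it x k.+1) (it x k)) _.
  rewrite [rho ^+ k.+1]exprS [(rho * _) ^+ 2]exprMn -[in leRHS]mulrA.
  exact: (ler_wpM2l (sqr_ge0 rho) IH).
have cvgi x i : cvgn (fun k => it x k ord0 i).
  have -> : (fun k => it x k ord0 i) = (fun k => it x 0%N ord0 i +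
      series (telescope (fun k => it x k ord0 i)) k).
    by apply/funext => k; exact: (eq_sum_telescope (fun k => it x k ord0 i)).
  apply: is_cvgD; first exact: is_cvg_cst.
  apply: normed_cvg; apply: (@series_le_cvg _ _ (geometric (Num.sqrt (D x)) rho)).
  - by move=> k; exact: normr_ge0.
  - by move=> k; rewrite /= mulr_ge0 ?sqrtr_ge0// exprn_ge0.
  - move=> k; rewrite /= /telescope /=.
    have -> : it x k.+1 ord0 i - it x k ord0 i = (it x k.+1 - it x k) ord0 i by rewrite !mxE.
    apply: le_trans (coord_le _ _) _; rewrite mulrC.
    have -> : rho ^+ k = Num.sqrt ((rho ^+ k) ^+ 2) by rewrite sqrtr_sqr ger0_norm ?exprn_ge0.
    by rewrite -sqrtrM ?sqr_ge0// ler_wsqrtr// step.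
  - by apply: is_cvg_geometric_series; rewrite ger0_norm.
pose w x : 'rV[R]_n := \row_i limn (fun k => it x k ord0 i).
have wl x i : it x k ord0 i @[k --> \oo] --> w x ord0 i by rewrite mxE; exact: cvgi.
exists w.
  apply: measurable_rVP => i.
  apply: (@measurable_fun_cvg _ _ _ _ (fun k x => it x k ord0 i)) => //.
  move=> k; suff H : measurable_fun [set: 'rV[R]_n] (fun x => it x k).
    exact: (measurableT_comp (measurable_coord i) H).
  elim: k => [|k IH]; first exact: measurable_cst.
  have mc (f : 'rV[R]_n -> 'rV[R]_n) l : measurable_fun setT f ->
      measurable_fun [set: 'rV[R]_n] (fun x => f x ord0 l).
    by move=> mf; exact: (measurableT_comp (measurable_coord l) mf).
  have E x l : it x k.+1 ord0 l = it x k ord0 l + eta * (x ord0 l -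
      (eps * it x k ord0 l + \sum_j c * Num.max (inner (v j) (it x k) - 1) 0 * v j ord0 l)).
    rewrite /it iterS -/(it x k) /g /penal !mxE summxE; congr (_ + _ * (_ - (_ + _))).
    by apply: eq_bigr => j _; rewrite mxE.
  apply: measurable_rVP => l; under eq_fun do rewrite E.
  apply: measurable_funD; first exact: mc.
  apply: measurable_funM => //; apply: measurable_funB; first exact: measurable_coord.
  apply: measurable_funD; first by apply: measurable_funM => //; exact: mc.
  apply: measurable_sum => j; apply: measurable_funM => //; apply: measurable_funM => //.
  apply: measurable_maxr => //; apply: measurable_funB => //.
  exact: measurable_inner.
move=> x.
have E0 : inner (it x k - w x) (it x k - w x) @[k --> \oo] --> (0 : R).
  rewrite (_ : 0 = \sum_(i < n) (0 : R)); last by rewrite big1.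
  apply: cvg_big_sum => i; rewrite -[X in _ --> X](mulr0 0).
  have Hi : (it x k - w x) ord0 i @[k --> \oo] --> (0 : R).
    rewrite (_ : (fun k => (it x k - w x) ord0 i) = (fun k => it x k ord0 i - w x ord0 i)).
      rewrite (_ : 0 = w x ord0 i - w x ord0 i); last by rewrite subrr.
      by apply: cvgB; [exact: wl|exact: cvg_cst].
    by apply/funext => k; rewrite [LHS]mxE [X in _ + X]mxE.
  exact: cvgM.
suff gw : g x (w x) = w x.
  move: gw; rewrite /g => /eqP; rewrite -subr_eq0 addrAC subrr add0r scaler_eq0.
  by rewrite gt_eqF//= subr_eq0 => /eqP.
apply/rowP => i.
have L1 : it x k.+1 ord0 i @[k --> \oo] --> w x ord0 i by rewrite (cvg_shiftS (fun k => it
    x k ord0 i)); exact: wl.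
apply: (cvg_unique _ _ L1); first exact: Rhausdorff.
have L0 : (rho ^+ 2 * inner (it x k - w x) (it x k - w x)) @[k --> \oo] --> (0 : R).
  by rewrite -[X in _ --> X](mulr0 (rho ^+ 2)); apply: cvgM => //; exact: cvg_cst.
have L2 : Num.sqrt (rho ^+ 2 * inner (it x k - w x) (it x k - w x)) @[k --> \oo] --> (0 : R).
  rewrite -[X in _ --> X]sqrtr0; apply: (cvg_comp _ _ L0); exact: sqrt_continuous.
apply/subr_cvg0; apply/norm_cvg0P.
apply: (@squeeze_cvgr _ _ _ _ (cst 0) (fun k => Num.sqrt (rho ^+ 2 * inner (it x k - w x)
    (it x k - w x)))) => //; last exact: cvg_cst.
near=> k; rewrite normr_ge0/=.
have -> : it x k.+1 ord0 i - g x (w x) ord0 i = (it x k.+1 - g x (w x)) ord0 i by rewrite !mxE.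
by apply: le_trans (coord_le _ _) _; rewrite ler_wsqrtr//; exact: ctr.
Unshelve. all: by end_near. Qed.

(** Pair the difference of the two equations with [w' - w], and let [I = <v_j, w' - w>].
    Monotonicity of the other terms gives [(ramp j w' - ramp j w) * I <= tau * I]. A larger increase
    of the ramp would force [I > 0] and contradict this. *)
Lemma penal_slope x j tau w w' : 0 <= tau -> penal w = x ->
  penal w' = x + tau *: v j -> ramp j w' <= ramp j w + tau.
Proof.
move=> tau0 wx w'x; rewrite leNgt; apply/negP => H.
have E := penal_sub w' w; have := congr1 (fun z => inner z (w' - w)) E.
rewrite w'x wx addrAC subrr add0r innerZl innerDl innerZl inner_suml (bigD1 j)//= innerZl.
set I := inner (v j) (w' - w) => E2.
have S0 : 0 <= \sum_(i < m | i != j) inner ((ramp i w' - ramp i w) *: v i) (w' - w).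
  by apply: sumr_ge0 => i _; rewrite innerZl ramp_mono.
have e0 : 0 <= eps * inner (w' - w) (w' - w) by rewrite mulr_ge0 ?inner_ge0// ltW.
have d0 := ramp_mono j w' w; rewrite -/I in d0.
have I0 : 0 < I.
  rewrite ltNge; apply/negP => I0; have I00 : I = 0 by nra.
  have : ramp j w' = ramp j w.
    by rewrite /ramp; move: I00; rewrite /I innerDr innerNr => /eqP; rewrite subr_eq0 =>
        /eqP ->.
  by move: H; lra.
nra.
Qed.

(** A nonzero ramp satisfies [<v_j, w> = 1 + ramp / c], so [Z] equals [eps |w| ^ 2] plus the sum of
    all [ramp + ramp ^ 2 / c]. The covering at [w] bounds [|w|] by [(1 + mu) / r], where [mu] is the
    violation of one constraint, and the quadratic term of that same ramp absorbs [mu]. *)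
Lemma penal_bounds (r : R) x w : 0 < r ->
  (exists j, r * norm2 w <= inner (v j) w) -> penal w = x ->
  let Z := inner x w in
  [/\ 0 <= Z, \sum_j ramp j w <= norm2 x / r + inner x x / (4 * r ^+ 2 * c),
     Z <= 2 * norm2 x / r + inner x x / (r ^+ 2 * c),
     \sum_j ramp j w * inner x (v j) = inner x x - eps * Z &
     forall j, ramp j w ^+ 2 <= c * Z].
Proof.
move=> r0 [j0 rj0] wx Z.
have rE j : ramp j w * inner (v j) w = ramp j w + ramp j w ^+ 2 / c.
  rewrite /ramp /Num.max; case: ltP => H; first by rewrite mulr0 mul0r expr0n mul0r addr0.
  by field; rewrite gt_eqF.
have ZE : Z = eps * inner w w + \sum_j (ramp j w + ramp j w ^+ 2 / c).
  rewrite /Z -wx /penal innerDl innerZl inner_suml; congr (_ + _).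
  by apply: eq_bigr => j _; rewrite innerZl rE.
have sq0 j : 0 <= ramp j w ^+ 2 / c by rewrite divr_ge0 ?sqr_ge0// ltW.
have ew0 : 0 <= eps * inner w w by rewrite mulr_ge0 ?inner_ge0// ltW.
have S0 : 0 <= \sum_j ramp j w by apply: sumr_ge0 => j _; exact: ramp_ge0.
have sumj j : \sum_j ramp j w + ramp j w ^+ 2 / c <= Z.
  rewrite ZE big_split/= [X in _ + (_ + X)](bigD1 j)//=.
  have : 0 <= \sum_(i < m | i != j) ramp i w ^+ 2 / c by exact: sumr_ge0.
  by lra.
have Z0 : 0 <= Z by apply: le_trans (sumj j0); rewrite addr_ge0.
pose mu := ramp j0 w / c.
have mu0 : 0 <= mu by rewrite divr_ge0 ?ramp_ge0// ltW.
have muE : ramp j0 w ^+ 2 / c = c * mu ^+ 2 by rewrite /mu; field; rewrite gt_eqF.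
have mu1 : inner (v j0) w <= 1 + mu.
  rewrite /mu /ramp mulrAC divff ?gt_eqF// mul1r -lerBlDl.
  by rewrite /Num.max; case: ltP => //; exact: ltW.
have x0 := sqrtr_ge0 (inner x x); have w0 := sqrtr_ge0 (inner w w).
have xE := sqr_sqrtr (inner_ge0 x).
have Zle : Z <= norm2 x * (1 + mu) / r.
  rewrite ler_pdivlMr//; have := inner_le x w; rewrite -/Z => H.
  have := ler_wpM2r (ltW r0) H; have := ler_wpM2l x0 (le_trans rj0 mu1).
  by rewrite mulrCA mulrA; lra.
have hS := sumj j0; rewrite muE in hS.
(* [sq1] spends all of [c * mu ^+ 2] and bounds the sum of the ramps; [sq2] spends half of it, which
   is at most [Z / 2], and bounds [Z]. *)
have sq1 : norm2 x * mu / r <= c * mu ^+ 2 + inner x x / (4 * r ^+ 2 * c).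
  rewrite -[X in _ + X / _]xE; move: (norm2 x) => a; rewrite -subr_ge0.
  rewrite (_ : _ - _ = c * (mu - a / (2 * r * c)) ^+ 2); first by rewrite pmulr_rge0// sqr_ge0.
  by field; rewrite !gt_eqF.
have sq2 : norm2 x * mu / r <= c * mu ^+ 2 / 2 + inner x x / (2 * r ^+ 2 * c).
  rewrite -[X in _ + X / _]xE; move: (norm2 x) => a; rewrite -subr_ge0.
  rewrite (_ : _ - _ = c / 2 * (mu - a / (r * c)) ^+ 2); first by rewrite pmulr_rge0
      ?sqr_ge0// divr_gt0.
  by field; rewrite !gt_eqF.
have Zle' : Z <= norm2 x / r + norm2 x * mu / r by rewrite -mulrDl -[X in X + _]mulr1 -mulrDr.
have hc : inner x x / (r ^+ 2 * c) = 2 * (inner x x / (2 * r ^+ 2 * c)) by field; rewrite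
    !gt_eqF.
have h2 : 2 * norm2 x / r = 2 * (norm2 x / r) by rewrite mulrA.
split => //.
- by lra.
- by rewrite hc h2; lra.
- rewrite (_ : \sum_j _ = inner x (x - eps *: w)).
    by rewrite innerDr innerNr innerZr.
  rewrite -[in X in inner _ (X - _)]wx /penal addrAC subrr add0r inner_sumr.
  by apply: eq_bigr => j _; rewrite innerZr.
- move=> j; rewrite mulrC -ler_pdivrMr//; have := sumj j; lra.
Qed.

End penalized.

(** * The covering inequality *)

Section main_inequality.
Variable R : realType.
Local Notation N := (@normal_prob R 0 1).
Local Notation phi := (@normal_pdf R 0 1).
Local Notation gauss n := (rV_measure (@normal_prob R 0 1) n).
Local Notation norm2 x := (Num.sqrt (inner x x)).

Definition mills (b : R) := gtail b / phi b.
Definition slope_loss (b : R) := mills b * gtail b - phi b + b * gtail b.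

Lemma integral_normal_cst (c : R) : (\int[N]_x c%:E = c%:E)%E.
Proof. by rewrite integral_cst//= probability_setT mule1. Qed.

Lemma integral_normal_affine_sqr (a c : R) : 0 <= a -> 0 <= c ->
  (\int[N]_x (a + c * x ^+ 2)%:E = (a + c)%:E)%E.
Proof.
move=> a0 c0; under eq_integral do rewrite EFinD EFinM.
have m2 : measurable_fun [set: measurableTypeR R] (fun x : measurableTypeR R => (x ^+ 2)%:E).
  by apply/measurable_EFinP; exact: measurable_funX.
rewrite ge0_integralD//; last 2 first.
- by move=> x _; rewrite mule_ge0// lee_fin ?sqr_ge0.
- exact: measurable_funeM.
rewrite integral_normal_cst ge0_integralZl//; last by move=> x _; rewrite lee_fin sqr_ge0.
by rewrite integral_normal_sqr mule1.
Qed.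

Lemma integral_gauss_affine_sqr n (a c : R) : 0 <= a -> 0 <= c ->
  (\int[gauss n]_x (a + c * inner x x)%:E = (a + c * n%:R)%:E)%E.
Proof.
move=> a0 c0; under eq_integral do rewrite EFinD EFinM.
have m2 : measurable_fun [set: 'rV[R]_n] (fun x : 'rV[R]_n => (inner x x)%:E).
  by apply/measurable_EFinP; exact: measurable_inner.
rewrite ge0_integralD//; last 2 first.
- by move=> x _; rewrite mule_ge0// lee_fin inner_ge0.
- exact: measurable_funeM.
rewrite integral_gauss_cst ge0_integralZl//; last by move=> x _; rewrite lee_fin inner_ge0.
by rewrite integral_gauss_sqr.
Qed.

(** The domination is used twice: it gives the integrability required by [integral_normal_slope],
    and its right side, of mean [D + C], is what is added to the integrand. *)
Lemma integral_normal_slope_shift (f : R -> R) (a : R -> R) (b C D : R) : 1 <= b ->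
  measurable_fun [set: measurableTypeR R] (f : measurableTypeR R -> R) ->
  (forall y, f y = a y * (1 - mills b * y)) ->
  (forall y, 0 <= a y) -> (forall x y, x <= y -> a y <= a x + (y - x)) ->
  0 <= C -> 0 <= D -> (forall y, `|f y| <= D + C * y ^+ 2) ->
  ((D + C - slope_loss b)%:E <= \int[N]_y (f y + (D + C * y ^+ 2))%:E)%E.
Proof.
move=> b1 mf fE a0 al C0 D0 fle.
have mq : measurable_fun [set: measurableTypeR R]
    (fun y : measurableTypeR R => (D + C * y ^+ 2)%:E).
  apply/measurable_EFinP; apply: measurable_funD => //.
  by apply: measurable_funM => //; exact: measurable_funX.
have q0 y : 0 <= D + C * y ^+ 2 by rewrite addr_ge0// mulr_ge0// sqr_ge0.
have iq : N.-integrable setT (fun y : measurableTypeR R => (D + C * y ^+ 2)%:E).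
  apply/integrableP; split => //.
  under eq_integral do rewrite gee0_abs ?lee_fin ?q0//.
  by rewrite integral_normal_affine_sqr// ltry.
have if_ : N.-integrable setT (fun y : measurableTypeR R => (f y)%:E).
  apply: (le_integrable _ _ _ iq) => //; first exact/measurable_EFinP.
  by move=> y _; rewrite !abse_EFin lee_fin (ger0_norm (q0 y)).
under eq_integral do rewrite EFinD.
rewrite integralD// integral_normal_affine_sqr// EFinB addeC leeD2r//.
have := @integral_normal_slope R a b b1 a0 al; rewrite -/(mills b) -/(slope_loss b) /=.
have -> : (fun y : measurableTypeR R => (a y * (1 - mills b * y))%:E) = (fun y => (f y)%:E).
  by apply/funext => y; rewrite fE.
exact.
Qed.

(* The summand [C * (1 + inner x x)] makes the integrand nonnegative, so that
   rotation invariance and Tonelli apply without integrability conditions. *)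
Lemma gauss_slope n (a : 'rV[R]_n.+2 -> R) (v : 'rV[R]_n.+2) (b C : R) :
  1 <= b -> inner v v = 1 -> measurable_fun setT a -> (forall x, 0 <= a x) ->
  (forall x tau, 0 <= tau -> a (x + tau *: v) <= a x + tau) ->
  slope_loss b <= C ->  0 <= C ->
  (forall x, `|a x * (1 - mills b * inner x v)| <= C * (1 + inner x x)) ->
  ((C * (1 + n.+2%:R) - slope_loss b)%:E <=
   \int[gauss n.+2]_x (a x * (1 - mills b * inner x v) + C * (1 + inner x x))%:E)%E.
Proof.
move=> b1 v1 ma a0 al KC C0 ale.
have [T [lT iT mT vT] Tv] := gauss_isometry_unit v1.
pose F (x : 'rV[R]_n.+2) := a x * (1 - mills b * inner x v).
have mF : measurable_fun setT F.
  apply: measurable_funM => //; apply: measurable_funB => //.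
  by apply: measurable_funM => //; exact: measurable_inner.
have mG : measurable_fun setT (fun x : 'rV[R]_n.+2 => (F x + C * (1 + inner x x))%:E).
  apply/measurable_EFinP; apply: measurable_funD => //.
  by apply: measurable_funM => //; apply: measurable_funD => //; exact: measurable_inner.
have G0 (x : 'rV[R]_n.+2) : (0 <= (F x + C * (1 + inner x x))%:E)%E.
  by have := ale x; rewrite lee_fin -/(F x) ler_norml => /andP[+ _]; lra.
rewrite -(vT _ mG G0).
rewrite ge0_integral_rVS_swap; last 2 first.
- exact: (measurableT_comp mG mT).
- by move=> x; exact: G0.
have -> : C * (1 + n.+2%:R) - slope_loss b = (2 * C - slope_loss b) + C * n.+1%:R.
  by rewrite -[n.+2]addn1 natrD; ring.
rewrite -integral_gauss_affine_sqr//; last by lra.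
apply: ge0_le_integral => //.
- by move=> y _; rewrite lee_fin addr_ge0 ?mulr_ge0 ?inner_ge0//; lra.
- apply/measurable_EFinP; apply: measurable_funD => //.
  by apply: measurable_funM => //; exact: measurable_inner.
- pose G := (fun x : 'rV[R]_n.+2 => (F (T x) + C * (1 + inner (T x) (T x)))%:E).
  apply: (@measurable_fun_fubini_tonelli_G _ _ _ _ _ N (G \o @cons_row R n.+1)).
  + apply: (measurableT_comp (f := G)); first exact: (measurableT_comp mG mT).
    exact: measurable_cons_row.
  + by move=> x; exact: G0.
move=> y _.
have E1 x : inner (T (cons_row (x, y))) v = x.
  by rewrite -Tv iT inner_e0 cons_row0.
have E2 x : inner (T (cons_row (x, y))) (T (cons_row (x, y))) = x ^+ 2 + inner y y.
  by rewrite iT inner_cons/= expr2.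
have -> : 2 * C - slope_loss b + C * inner y y = C * (1 + inner y y) + C - slope_loss b.
  by ring.
have := @integral_normal_slope_shift (fun x => F (T (cons_row (x, y))))
  (fun x => a (T (cons_row (x, y)))) b C (C * (1 + inner y y)) b1.
move=> H; apply: (le_trans (H _ _ _ _ _ _ _)) => {H} //.
- apply: (measurableT_comp mF); apply: (measurableT_comp mT).
  exact: measurable_cons_pair.
- by move=> x; rewrite /F E1.
- move=> x x' xx'.
  have -> : T (cons_row (x', y)) = T (cons_row (x, y)) + (x' - x) *: v.
    rewrite addrC -Tv -lT -cons_row_linear scaler0 add0r.
    by congr (T (cons_row (_, _))); ring.
  by apply: al; rewrite subr_ge0.
- by rewrite mulr_ge0// addr_ge0// inner_ge0.
- by move=> x; have := ale (T (cons_row (x, y))); rewrite -/(F _) E2; lra.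
rewrite le_eqVlt; apply/orP; left; apply/eqP; apply: eq_integral => x _.
by rewrite E2; congr (_ + _)%:E; ring.
Qed.

Lemma ler_abs_mul (x y : R) : `|x * y| <= (x ^+ 2 + y ^+ 2) / 2.
Proof.
rewrite ler_norml; have := sqr_ge0 (x + y); have := sqr_ge0 (x - y).
by rewrite !expr2 => H1 H2; apply/andP; split; lra.
Qed.

Lemma mills_gt0 b : 1 <= b -> 0 < mills b.
Proof. by move=> b1; rewrite divr_gt0 ?gtail_gt0 ?phi_gt0. Qed.

Lemma cover_bound_penal n m (v : 'I_m -> 'rV[R]_n.+2) (r b eps c s : R) :
  (forall j, inner (v j) (v j) = 1) -> 0 < r ->
  (forall w, exists j, r * norm2 w <= inner (v j) w) ->
  1 <= b -> 0 < eps -> 0 < c -> s = Num.sqrt n.+2%:R ->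
  mills b * n.+2%:R - m%:R * slope_loss b <=
  s / r + n.+2%:R / (4 * r ^+ 2 * c) +
  mills b * eps * (2 * s / r + n.+2%:R / (r ^+ 2 * c)).
Proof.
move=> v1 r0 cov b1 eps0 c0 sdef.
have M0 := mills_gt0 b1; set M := mills b in M0 *; set K := slope_loss b.
have [w mw wE] := penal_inverse v1 eps0 c0.
pose a j x := ramp v c j (w x).
have bounds x := penal_bounds eps0 c0 r0 (cov (w x)) (wE x).
have s0 : 0 < s by rewrite sdef sqrtr_gt0 ltr0n.
have sE : s ^+ 2 = n.+2%:R by rewrite sdef sqr_sqrtr// ler0n.
have Me0 : 0 < M * eps by exact: mulr_gt0 M0 eps0.
have [j0 _] := cov 0.
have m1 : 1 <= m%:R :> R by rewrite ler1n (leq_trans _ (ltn_ord j0)).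
pose B := r^-1 + (r ^+ 2 * c)^-1.
have rc0 : 0 < (r ^+ 2 * c)^-1 by rewrite invr_gt0 mulr_gt0// exprn_gt0.
have r10 : 0 < r^-1 by rewrite invr_gt0.
have B0 : 0 < B by rewrite addr_gt0.
(* The first three terms dominate the products in [ale], the term in [K] gives [KC], and the last
   [M] makes [beta] nonnegative. The contributions of [C] cancel at the end. *)
pose C := c * B + 2 + 2 * M ^+ 2 + `|K| + M.
have cB0 : 0 < c * B by rewrite mulr_gt0.
have MM0 : 0 <= M ^+ 2 by rewrite sqr_ge0.
have C0 : 0 < C by rewrite /C; have := normr_ge0 K; lra.
have KC : K <= C by rewrite /C; have := ler_norm K; lra.
have ale j x : `|a j x * (1 - M * inner x (v j))| <= C * (1 + inner x x).
  apply: le_trans (ler_abs_mul _ _) _.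
  have [Z0 _ Zle _ a2] := bounds x.
  have q0 := inner_ge0 x; have xq := sqr_sqrtr q0; have y2 := inner_sqr_le x (v j).
  rewrite v1 mulr1 in y2.
  have x1 : 2 * norm2 x <= 1 + inner x x.
    by rewrite -[in leRHS]xq; have := sqr_ge0 (norm2 x - 1); rewrite !expr2; lra.
  have ZB : inner x (w x) <= B * (1 + inner x x).
    apply: le_trans Zle _; rewrite /B mulrDl.
    have : inner x x / (r ^+ 2 * c) <= (r ^+ 2 * c)^-1 * (1 + inner x x).
      by rewrite mulrC ler_pM2l//; lra.
    have : 2 * norm2 x / r <= (1 + inner x x) / r by rewrite ler_pM2r.
    lra.
  have a2' : a j x ^+ 2 <= c * B * (1 + inner x x).
    by apply: le_trans (a2 j) _; rewrite -mulrA ler_pM2l.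
  have y3 : (1 - M * inner x (v j)) ^+ 2 <= 2 + 2 * M ^+ 2 * inner x x.
    apply: (@le_trans _ _ (2 + 2 * (M ^+ 2 * inner x (v j) ^+ 2))).
      have := sqr_ge0 (1 + M * inner x (v j)); rewrite -exprMn.
      by move: (M * _) => z; rewrite !expr2; lra.
    by rewrite lerD2l -[leRHS]mulrA ler_pM2l// ler_wpM2l.
  have H1 : 0 <= c * B * (1 + inner x x) by rewrite mulr_ge0 ?ltW//; lra.
  have H2 : 0 <= M ^+ 2 * inner x x by rewrite mulr_ge0.
  have H3 : 0 <= (`|K| + M) * (1 + inner x x) by rewrite mulr_ge0 ?addr_ge0//; lra.
  by rewrite /C; lra.
have ma j : measurable_fun setT (a j).
  apply: measurable_funM => //; apply: measurable_maxr => //; apply: measurable_funB => //.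
  exact: measurable_inner.
have al j x tau : 0 <= tau -> a j (x + tau *: v j) <= a j x + tau.
  by move=> tau0; apply: (penal_slope eps0 c0 tau0 (wE x)).
have a0 j x : 0 <= a j x by exact: ramp_ge0.
have low j := gauss_slope b1 (v1 j) (ma j) (a0 j) (al j) KC (ltW C0) (ale j).
pose alpha := s / (2 * r) + M * eps * s / r + m%:R * C.
pose beta := (2 * r * s)^-1 + (4 * r ^+ 2 * c)^-1 - M +
  M * eps * ((r * s)^-1 + (r ^+ 2 * c)^-1) + m%:R * C.
have alpha0 : 0 <= alpha.
  have : 0 < s / (2 * r) by rewrite divr_gt0// mulr_gt0.
  have : 0 < M * eps * s / r by exact: divr_gt0 (mulr_gt0 Me0 s0) r0.
  have : 0 < m%:R * C by rewrite mulr_gt0//; lra.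
  by rewrite /alpha; lra.
have beta0 : 0 <= beta.
  have : M <= m%:R * C.
    have : C <= m%:R * C by rewrite ler_peMl// ltW.
    by apply: le_trans; rewrite /C; have := normr_ge0 K; lra.
  have : 0 < (2 * r * s)^-1 by rewrite invr_gt0 !mulr_gt0.
  have : 0 < (4 * r ^+ 2 * c)^-1 by rewrite invr_gt0 !mulr_gt0// exprn_gt0.
  have : 0 < M * eps * ((r * s)^-1 + (r ^+ 2 * c)^-1).
    apply: (mulr_gt0 Me0); rewrite addr_gt0// invr_gt0; first exact: mulr_gt0.
  by rewrite /beta; lra.
have sum_le x : \sum_j (a j x * (1 - M * inner x (v j)) + C * (1 + inner x x)) <=
    alpha + beta * inner x x.
  have [Z0 Sle Zle Say _] := bounds x.
  rewrite big_split/= sumr_const card_ord -mulr_natl.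
  have -> : \sum_j a j x * (1 - M * inner x (v j)) =
      \sum_j a j x - M * (inner x x - eps * inner x (w x)).
    rewrite -Say mulr_sumr -sumrB; apply: eq_bigr => j _; rewrite /a; ring.
  have q0 := inner_ge0 x; have xq := sqr_sqrtr q0.
  (* This reduces the mean of [|x|] to the second moment; with [s ^+ 2] equal to the dimension, the
     right side has mean exactly [s]. *)
  have x1 : norm2 x <= (inner x x / s + s) / 2.
    rewrite -subr_ge0 (_ : _ - _ = (norm2 x - s) ^+ 2 / (2 * s)); last first.
      by rewrite sqrrB xq; move: (norm2 x) (inner x x) => z q; field; rewrite gt_eqF.
    by rewrite divr_ge0 ?sqr_ge0// mulr_ge0// ltW.
  have x2 : norm2 x / r <= (inner x x / s + s) / 2 / r by rewrite ler_pM2r.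
  have x3 : M * eps * inner x (w x) <= M * eps * (2 * ((inner x x / s + s) / 2 / r) + inner
      x x / (r ^+ 2 * c)).
    rewrite (ler_pM2l Me0); apply: le_trans Zle _; rewrite lerD2r -mulrA ler_pM2l//.
  have -> : alpha + beta * inner x x = (inner x x / s + s) / 2 / r + inner x x / (4 * r ^+
      2 * c)
     - M * inner x x + M * eps * (2 * ((inner x x / s + s) / 2 / r) + inner x x / (r ^+ 2 * c))
     + m%:R * (C * (1 + inner x x)).
    by rewrite /alpha /beta; field; rewrite !gt_eqF.
  rewrite lerD2r; move: Sle; rewrite /a; lra.
have up : (\sum_(j < m) (C * (1 + n.+2%:R) - K)%:E <= (alpha + beta * n.+2%:R)%:E)%E.
  rewrite -integral_gauss_affine_sqr//.
  apply: (@le_trans _ _ (\sum_(j < m) \int[gauss n.+2]_x (a j x * (1 - M * inner x (v j)) +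
      C * (1 + inner x x))%:E)%E).
    by apply: lee_sum => j _; exact: low.
  have mf j : measurable_fun setT (fun x : 'rV[R]_n.+2 => (a j x * (1 - M * inner x (v j))
      + C * (1 + inner x x))%:E).
    apply/measurable_EFinP; apply: measurable_funD.
      apply: measurable_funM => //; apply: measurable_funB => //.
      by apply: measurable_funM => //; exact: measurable_inner.
    by apply: measurable_funM => //; apply: measurable_funD => //; exact: measurable_inner.
  have f0 j (x : 'rV[R]_n.+2) : (0 <= (a j x * (1 - M * inner x (v j)) + C * (1 + inner x
      x))%:E)%E.
    by have := ale j x; rewrite lee_fin ler_norml => /andP[+ _]; lra.
  rewrite -ge0_integral_sum//.
  apply: ge0_le_integral => //.
  - by move=> x _; apply: sume_ge0 => j _; exact: f0.
  - exact: emeasurable_sum.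
  - apply/measurable_EFinP; apply: measurable_funD => //.
    by apply: measurable_funM => //; exact: measurable_inner.
  - by move=> x _; rewrite sumEFin lee_fin.
move: up; rewrite sumEFin lee_fin sumr_const card_ord -[X in X <= _]mulr_natl.
have -> : alpha + beta * n.+2%:R = s / r + n.+2%:R / (4 * r ^+ 2 * c) - M * n.+2%:R
  + M * eps * (2 * s / r + n.+2%:R / (r ^+ 2 * c)) + m%:R * (C * (1 + n.+2%:R)).
  by rewrite /alpha /beta -sE; field; rewrite !gt_eqF.
lra.
Qed.

Lemma cover_bound n m (v : 'I_m -> 'rV[R]_n.+2) (r b : R) :
  (forall j, inner (v j) (v j) = 1) -> 0 < r ->
  (forall w, exists j, r * norm2 w <= inner (v j) w) -> 1 <= b ->
  mills b * n.+2%:R <= Num.sqrt n.+2%:R / r + m%:R * slope_loss b.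
Proof.
move=> v1 r0 cov b1; rewrite -lerBlDr; apply/ler_addgt0Pr => e e0.
pose P : R := n.+2%:R / (2 * r ^+ 2).
have P0 : 0 <= P by rewrite divr_ge0// mulr_ge0// sqr_ge0.
pose c := (P + 1) / e; have c0 : 0 < c by rewrite divr_gt0//; lra.
pose X := mills b * (2 * Num.sqrt n.+2%:R / r + n.+2%:R / (r ^+ 2 * c)).
have X0 : 0 <= X.
  apply: mulr_ge0; first exact: ltW (mills_gt0 b1).
  have rc0 : 0 < r ^+ 2 * c by rewrite mulr_gt0// exprn_gt0.
  apply: addr_ge0; last by rewrite divr_ge0// ltW.
  by rewrite divr_ge0 ?(ltW r0)// mulr_ge0// sqrtr_ge0.
(* Chosen after [c], on which [X] depends; each error term is then at most [e / 2]. *)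
pose eps := e / (2 * X + 1); have eps0 : 0 < eps by rewrite divr_gt0//; lra.
have := cover_bound_penal v1 r0 cov b1 eps0 c0 erefl.
have -> : mills b * eps * (2 * Num.sqrt n.+2%:R / r + n.+2%:R / (r ^+ 2 * c)) = eps * X.
  by rewrite /X; ring.
have H1 : eps * X <= e / 2.
  rewrite /eps mulrAC ler_pdivrMr; last by lra.
  by rewrite mulrAC ler_pdivlMr//; nra.
have H2 : n.+2%:R / (4 * r ^+ 2 * c) <= e / 2.
  have -> : n.+2%:R / (4 * r ^+ 2 * c) = P / (P + 1) * (e / 2).
    have nE : n.+2%:R = P * (2 * r ^+ 2) by rewrite /P divfK// gt_eqF// mulr_gt0// exprn_gt0.
    have P1 : P + 1 != 0 by rewrite gt_eqF//; lra.
    rewrite /c nE; move: (P) P1 => P' P1; field.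
    by rewrite P1 !gt_eqF.
  rewrite ler_piMl//; first by lra.
  by rewrite ler_pdivrMr; lra.
lra.
Qed.

End main_inequality.

(** * Quantitative consequences *)

Section estimates.
Variable R : realType.
Local Notation N := (@normal_prob R 0 1).
Local Notation phi := (@normal_pdf R 0 1).
Local Notation gauss n := (rV_measure (@normal_prob R 0 1) n).
Local Notation norm2 x := (Num.sqrt (inner x x)).
Implicit Types b t : R.

Lemma gtail_mills b : gtail b = phi b * mills b.
Proof. by rewrite /mills mulrC divfK// gt_eqF// phi_gt0. Qed.

Lemma mills_lower b : 1 <= b -> b / (b ^+ 2 + 1) <= mills b.
Proof.
move=> b1; have := gtail_lower b1; rewrite gtail_mills.
by rewrite (ler_pM2l (phi_gt0 b)).
Qed.

Lemma mills_upper b : 1 <= b -> mills b <= (b ^+ 2 + 2) / (b * (b ^+ 2 + 3)).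
Proof.
move=> b1; have := gtail_upper b1; rewrite gtail_mills.
by rewrite (ler_pM2l (phi_gt0 b)).
Qed.

(** With [x = mills b], the loss is [phi b * (x ^+ 2 - 1 + b * x)], increasing in [x > 0], so
    [mills_upper] can be substituted. *)
Lemma slope_loss_upper b : 1 <= b ->
  slope_loss b <= phi b * ((b ^+ 2 + 4) / (b ^+ 2 * (b ^+ 2 + 3) ^+ 2)).
Proof.
move=> b1; have M0 := mills_gt0 b1; have := mills_upper b1.
rewrite /slope_loss gtail_mills.
move: (mills b) (phi b) (phi_gt0 b) M0 => x p p0 x0 xU.
have b0 : 0 < b by lra.
have b3 : 0 < b ^+ 2 + 3 by have := sqr_ge0 b; lra.
have -> : x * (p * x) - p + b * (p * x) = p * (x ^+ 2 - 1 + b * x) by ring.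
rewrite ler_pM2l//.
have -> : (b ^+ 2 + 4) / (b ^+ 2 * (b ^+ 2 + 3) ^+ 2) =
   ((b ^+ 2 + 2) / (b * (b ^+ 2 + 3))) ^+ 2 - 1 + b * ((b ^+ 2 + 2) / (b * (b ^+ 2 + 3))).
  by field; rewrite !gt_eqF.
apply: lerD; last by rewrite ler_pM2l.
by rewrite lerD2r ler_pXn2r// nnegrE ltW// (lt_le_trans x0).
Qed.

(** For [b = t - k / t], [mills b] is about [1 / t + (k - 1) / t ^ 3], while [phi b] exceeds [phi t]
    by a factor of at most [exp k]. The value [k = 3] leaves room to prove the margin [1 / t ^ 3]
    for every [t >= 3]. *)
Lemma cover_bound_optimized (d m t : R) : 0 < d -> 0 <= m -> 3 <= t ->
  let b := t - 3 / t in
  mills b * d <= d / t + m * slope_loss b -> d <= 4 * (m * phi b / t).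
Proof.
move=> d0 m0 t3 b; have t0 : 0 < t by lra.
have t1 : 3 / t <= 1 by rewrite ler_pdivrMr; lra.
have b1 : 1 <= b by rewrite /b; lra.
have b0 : 0 < b by lra.
have bt : b * t = t ^+ 2 - 3 by rewrite /b; field; rewrite gt_eqF.
have T9 : 9 <= t ^+ 2 by nra.
have t20 : 0 < t ^+ 2 by lra.
have BT : b ^+ 2 * t ^+ 2 = (t ^+ 2 - 3) ^+ 2 by rewrite -exprMn bt.
have B1 : t ^+ 2 - 6 <= b ^+ 2 by rewrite -(ler_pM2r t20) BT; nra.
have B2 : b ^+ 2 <= t ^+ 2 - 5 by rewrite -(ler_pM2r t20) BT; nra.
have B3 : 4 * t ^+ 2 <= 9 * b ^+ 2.
  rewrite -(ler_pM2r t20) -[leRHS]mulrA BT.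
  have : 2 * t ^+ 2 <= 3 * (t ^+ 2 - 3) by lra.
  by nra.
have B4 : 4 <= b ^+ 2 by lra.
have p0 := phi_gt0 b.
have M1 : t^-1 + t ^- 3 <= mills b.
  apply: le_trans (mills_lower b1).
  rewrite ler_pdivlMr; last by lra.
  have t30 : 0 < t ^+ 3 by rewrite exprn_gt0.
  rewrite -(ler_pM2r t30).
  have -> : (t^-1 + t ^- 3) * (b ^+ 2 + 1) * t ^+ 3 = (t ^+ 2 + 1) * (b ^+ 2 + 1).
    by field; rewrite gt_eqF.
  have -> : b * t ^+ 3 = (t ^+ 2 - 3) * t ^+ 2 by rewrite -bt; ring.
  rewrite -(ler_pM2r t20).
  have -> : (t ^+ 2 + 1) * (b ^+ 2 + 1) * t ^+ 2 = (t ^+ 2 + 1) * (b ^+ 2 * t ^+ 2 + t ^+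
      2) by ring.
  by rewrite BT; move: (t ^+ 2) T9 => T; nra.
have K1 : slope_loss b <= phi b * (4 / t ^+ 4).
  apply: le_trans (slope_loss_upper b1) _; rewrite (ler_pM2l p0).
  have b20 : 0 < b ^+ 2 by lra.
  rewrite ler_pdivrMr; last by rewrite mulr_gt0// exprn_gt0//; lra.
  rewrite mulrAC ler_pdivlMr ?exprn_gt0//.
  have -> : t ^+ 4 = (t ^+ 2) ^+ 2 by rewrite -exprM.
  move: (b ^+ 2) (t ^+ 2) B1 B3 B4 T9 => B T ? ? ? ?.
  have h1 : 8 / 27 * T ^+ 2 <= B * (B + 3).
    have : 4 / 9 * T * (2 / 3 * T) <= B * (B + 3) by apply: ler_pM; lra.
    by rewrite !expr2; lra.
  have h2 : (B + 4) <= 8 / 7 * (B + 3) by lra.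
  have h3 : 8 / 27 * T ^+ 2 * (B + 3) <= B * (B + 3) * (B + 3) by rewrite ler_pM2r//; lra.
  have h4 : (B + 4) * T ^+ 2 <= 8 / 7 * (B + 3) * T ^+ 2 by rewrite ler_wpM2r// sqr_ge0.
  have h5 : 0 <= (B + 3) * T ^+ 2 by rewrite mulr_ge0 ?sqr_ge0//; lra.
  have -> : 4 * (B * (B + 3) ^+ 2) = 4 * (B * (B + 3) * (B + 3)) by ring.
  lra.
move=> H.
have H1 : d / t + d * t ^- 3 <= d / t + m * (phi b * (4 / t ^+ 4)).
  apply: (@le_trans _ _ (mills b * d)).
    by rewrite -mulrDr mulrC ler_pM2r.
  by apply: le_trans H _; rewrite lerD2l ler_wpM2l.
rewrite lerD2l in H1.
have t30 : 0 < t ^- 3 by rewrite invr_gt0 exprn_gt0.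
rewrite -(ler_pM2r t30); apply: le_trans H1 _.
rewrite le_eqVlt; apply/orP; left; apply/eqP.
by move: (phi b) => p; field; rewrite gt_eqF.
Qed.

(** With [b = t - 3 / t], [b ^+ 2 >= t ^+ 2 - 6] gives [s ^+ 2 - b ^+ 2 <= 8], whence the factor
    [expR (- 4)]. The factor [3 / 4] comes from [3 * (s ^+ 2 + 1) <= 4 * t ^+ 2], valid since
    [t ^+ 2 >= 9]. *)
Lemma gtail_compare t s : 3 <= t -> 0 < s -> t ^+ 2 <= s ^+ 2 <= t ^+ 2 + 2 ->
  expR (- 4) * (3 / 4) * (phi (t - 3 / t) / t) <= gtail s.
Proof.
move=> t3 s0 /andP[s1 s2]; have t0 : 0 < t by lra.
set b := t - 3 / t.
have ts : t <= s by rewrite -ler_sqr ?nnegrE ?(ltW t0) ?(ltW s0).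
have T9 : 9 <= t ^+ 2 by nra.
have t20 : 0 < t ^+ 2 by lra.
have bt : b * t = t ^+ 2 - 3 by rewrite /b; field; rewrite gt_eqF.
have BT : b ^+ 2 * t ^+ 2 = (t ^+ 2 - 3) ^+ 2 by rewrite -exprMn bt.
have B1 : t ^+ 2 - 6 <= b ^+ 2 by rewrite -(ler_pM2r t20) BT; nra.
have s11 : 1 <= s by lra.
apply: le_trans (gtail_lower s11).
have E : expR (- 4) * phi b <= phi s.
  rewrite !phiE mulrCA ler_pM2l ?kappa_gt0// -expRD ler_expR; lra.
have F : 3 / (4 * t) <= s / (s ^+ 2 + 1).
  rewrite ler_pdivlMr; last by lra.
  rewrite mulrAC ler_pdivrMr ?mulr_gt0//.
  have : t * t <= s * t by rewrite ler_pM2r.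
  by rewrite !expr2 in s2 T9 *; lra.
have -> : expR (- 4) * (3 / 4) * (phi b / t) = expR (- 4) * phi b * (3 / (4 * t)).
  by move: (phi b) (expR _) => p e; field; rewrite gt_eqF.
apply: ler_pM => //.
  by rewrite mulr_ge0 ?expR_ge0// normal_pdf_ge0.
by rewrite divr_ge0// mulr_ge0// ltW.
Qed.

Lemma gtail_nincr (s t : R) : 0 <= s -> s <= t -> gtail t <= gtail s.
Proof.
move=> s0 st; have := @gtail_tangent R s t s0 (le_trans s0 st).
have := mulr_ge0 (ltW (phi_gt0 t)) (_ : 0 <= t - s).
rewrite subr_ge0 => /(_ st); move: (phi t) => p; lra.
Qed.

(** The first entry is the constant of [gtail_compare] divided by the [4] of
    [cover_bound_optimized], for [t >= 3]. For [t < 3] the volume itself is at least [gtail 6]. *)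
Definition cover_const : R := Num.min (expR (- 4) * (3 / 16)) (gtail 6).

Lemma cover_const_gt0 : 0 < cover_const.
Proof. by rewrite lt_min mulr_gt0 ?expR_gt0 ?gtail_gt0//=; lra. Qed.

(** With fewer poles than dimensions, some nonzero [w] is orthogonal to all of them. *)
Lemma cover_card n m (v : 'I_m -> 'rV[R]_n) (r : R) : 0 < r ->
  (forall w, exists j, r * norm2 w <= inner (v j) w) -> (n <= m)%N.
Proof.
move=> r0 cov; rewrite leqNgt; apply/negP => mn.
pose A : 'M[R]_(n, m) := \matrix_(i, j) v j ord0 i.
have : kermx A != 0.
  rewrite -mxrank_eq0 mxrank_ker subn_eq0 -ltnNge.
  by apply: leq_ltn_trans mn; exact: rank_leq_col.
move=> /rowV0Pn[w /sub_kermxP wA w0].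
have [j] := cov w; have -> : inner (v j) w = 0.
  have /rowP/(_ j) := wA; rewrite !mxE => <-.
  by apply: eq_bigr => i _; rewrite mxE mulrC.
by apply/negP; rewrite -ltNge mulr_gt0// norm2_gt0.
Qed.

Lemma cover_volume n m (v : 'I_m -> 'rV[R]_n.+2) (r delta : R) :
  (forall j, inner (v j) (v j) = 1) -> 0 < r ->
  (forall w, exists j, r * norm2 w <= inner (v j) w) ->
  delta%:E = gauss n.+2 (polar_cap r) ->
  (r * Num.sqrt n.+2%:R) ^+ 4 <= n.+2%:R -> (13 <= n.+2)%N ->
  cover_const * n.+2%:R <= m%:R * delta.
Proof.
move=> v1 r0 cov dE; set t := r * Num.sqrt _ => t4 n13.
pose d : R := n.+2%:R.
have d13 : 13 <= d by rewrite ler_nat.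
have tE : t ^+ 2 = r ^+ 2 * d by rewrite exprMn sqr_sqrtr// ler0n.
have nm : d <= m%:R by rewrite ler_nat (cover_card r0 cov).
have t0 : 0 < t by rewrite mulr_gt0// sqrtr_gt0 ltr0n.
rewrite -/d in t4 *.
have t22 : t ^+ 4 = t ^+ 2 * t ^+ 2 by rewrite -exprD.
have r20 : 0 < r ^+ 2 by rewrite exprn_gt0.
have t20 : 0 < t ^+ 2 by rewrite exprn_gt0.
have td : t ^+ 2 < d by rewrite ltNge; apply/negP => H; nra.
have r21 : r ^+ 2 < 1 by rewrite -(ltr_pM2r (lt_le_trans _ d13)) -?tE ?mul1r//; lra.
have r1 : r < 1 by rewrite -(ltr_pXn2r (ltn0Sn 1)) ?nnegrE ?ltW// expr1n.
pose s := Num.sqrt (r ^+ 2 * n.+1%:R / (1 - r ^+ 2)).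
have s20 : 0 < r ^+ 2 * n.+1%:R / (1 - r ^+ 2).
  by rewrite divr_gt0 ?mulr_gt0 ?ltr0n ?subr_gt0.
have s0 : 0 < s by rewrite sqrtr_gt0.
have sE : s ^+ 2 * (1 - r ^+ 2) = r ^+ 2 * n.+1%:R.
  by rewrite sqr_sqrtr ?ltW// divfK// gt_eqF// subr_gt0.
have sE' : s ^+ 2 * (d - t ^+ 2) = t ^+ 2 * (d - 1).
  have -> : d - 1 = n.+1%:R by rewrite /d -[n.+2]addn1 natrD addrK.
  by rewrite tE; have := congr1 (fun z => z * d) sE; rewrite /=; lra.
have := gauss_cap_lower r0 r1 s0 sE; rewrite -dE lee_fin => low.
have ltd : 0 < d - t ^+ 2 by lra.
have [t3|t3] := leP 3 t; last first.
  apply: (@le_trans _ _ (gtail 6 * d)).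
    by rewrite ler_pM2r ?ge_min ?lexx ?orbT//; lra.
  (* Here [t ^+ 2 <= 9], and [9 * (d - 1) <= 36 * (d - 9)] holds from [d = 13] on. *)
  have s6 : s <= 6.
    rewrite -ler_sqr ?nnegrE ?(ltW s0)// -(ler_pM2r ltd) sE'.
    have : t ^+ 2 <= 9 by nra.
    by move: (t ^+ 2) => T; nra.
  have l6 := le_trans (gtail_nincr (ltW s0) s6) low.
  have g6 := gtail_ge0 (6 : R).
  by rewrite mulrC; apply: ler_pM => //; lra.
have T9 : 9 <= t ^+ 2 by nra.
(* The difference [s ^+ 2 - t ^+ 2] is [t ^+ 2 * (t ^+ 2 - 1) / (d - t ^+ 2)], at most [2] because
   [t ^+ 4 <= d]. *)
have st : t ^+ 2 <= s ^+ 2 <= t ^+ 2 + 2.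
  rewrite -(ler_pM2r ltd) -[X in _ && X](ler_pM2r ltd) sE'.
  by apply/andP; split; move: (t ^+ 2) T9 t22 t4 td => T *; nra.
have dl := le_trans (gtail_compare t3 s0 st) low.
have sd : Num.sqrt d / r = d / t.
  rewrite /t -/d -[X in _ = X / _](sqr_sqrtr (_ : 0 <= d)) ?ler0n//.
  by field; rewrite !gt_eqF// sqrtr_gt0; lra.
have b1 : 1 <= t - 3 / t.
  have : 3 / t <= 1 by rewrite ler_pdivrMr; lra.
  by lra.
have := cover_bound v1 r0 cov b1; rewrite -/d sd => H.
have d0 : 0 < d by lra.
have H4 := cover_bound_optimized d0 (ler0n R m) t3 H.
apply: (@le_trans _ _ (expR (- 4) * (3 / 16) * d)).
  by rewrite ler_pM2r ?ge_min ?lexx.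
have e0 : 0 < expR (- 4 : R) by exact: expR_gt0.
apply: (@le_trans _ _ (m%:R * (expR (- 4) * (3 / 4) * (phi (t - 3 / t) / t)))); last first.
  by rewrite ler_wpM2l.
have := ler_wpM2l (ltW e0) H4; move: (t^-1) => t'; move: (phi _) (expR _) => p e.
have -> : m%:R * (e * (3 / 4) * (p * t')) = 3 / 16 * (e * (4 * (m%:R * p * t'))) by field.
lra.
Qed.

(** Were [t ^+ 2] above [sqrt n], for [n] the dimension, both terms of [gauss_cap_upper] would be at
    most [exp (- sqrt n / 8)], forcing [exp (sqrt n / 16) <= 2]. From [257 = 16 ^ 2 + 1] on,
    [sqrt n > 16] excludes this. *)
Lemma cap_height_upper n (r delta : R) : 0 < r ->
  delta%:E = gauss n.+2 (polar_cap r) -> (257 <= n.+2)%N ->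
  expR (- (Num.sqrt n.+2%:R / 16)) <= delta ->
  (r * Num.sqrt n.+2%:R) ^+ 4 <= n.+2%:R.
Proof.
move=> r0 dE n257 dl; set s := Num.sqrt _ in dl *; set t := r * s.
pose d : R := n.+2%:R.
have sE : s ^+ 2 = d by rewrite sqr_sqrtr// ler0n.
have d257 : 257 <= d by rewrite ler_nat.
have s0 : 0 < s by rewrite sqrtr_gt0 ltr0n.
have s16 : 16 < s by nra.
have t0 : 0 < t by rewrite mulr_gt0.
rewrite leNgt; apply/negP => t4; rewrite -/d in t4.
have ts : s < t ^+ 2.
  rewrite -(ltr_pXn2r (ltn0Sn 1)) ?nnegrE ?sqr_ge0 ?ltW//.
  by rewrite sE -exprM.
have t2 : 2 <= t by nra.
have := gauss_cap_upper r0 (erefl t) t2; rewrite -dE lee_fin -/d => up.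
have k1 : normal_peak 1 <= 1 :> R.
  rewrite /normal_peak invf_le1 ?sqrtr_gt0; last by rewrite expr1n mul1r pmulrn_lgt0 ?pi_gt0.
  rewrite -[leLHS]sqrtr1 ler_wsqrtr// expr1n mul1r mulr2n.
  have := pi_ge2 R; lra.
have e1 : phi (t / 2) <= expR (- (s / 8)).
  rewrite phiE; apply: (@le_trans _ _ (1 * expR (- (t / 2) ^+ 2 / 2))).
    by rewrite ler_pM2r ?expR_gt0.
  by rewrite mul1r ler_expR; lra.
(* Since [exp (1 / 4) <= sqrt 2], the left side is at most [exp (d / 8 - d / 4)], and [d >= s]. *)
have e2 : expR (d / 8) * (Num.sqrt 2)^-1 ^+ n.+2 <= expR (- (s / 8)).
  have q : expR (1 / 4) <= Num.sqrt 2 :> R.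
    have h : expR (1 / 4) * (3 / 4) <= 1 :> R.
      have : 1 + (- (1 / 4)) <= expR (- (1 / 4)) :> R by exact: expR_ge1Dx.
      rewrite expRN -(ler_pM2l (expR_gt0 (1 / 4 : R))) divff ?gt_eqF ?expR_gt0//.
      by move: (expR _) => e; lra.
    apply: (@le_trans _ _ (4 / 3)); first by move: (expR _) h => e; lra.
    have h0 : 0 <= 4 / 3 :> R by lra.
    rewrite -ler_sqr ?nnegrE ?sqrtr_ge0//.
    have -> : Num.sqrt 2 ^+ 2 = 2 :> R by rewrite sqr_sqrtr.
    lra.
  have s2 : 0 < Num.sqrt 2 :> R by rewrite sqrtr_gt0.
  apply: (@le_trans _ _ (expR (d / 8) * expR (- (1 / 4)) ^+ n.+2)).
    rewrite ler_pM2l ?expR_gt0// lerXn2r ?nnegrE ?expR_ge0 ?invr_ge0 ?sqrtr_ge0//.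
    by rewrite expRN lef_pV2 ?posrE ?expR_gt0.
  rewrite -expRM_natl -expRD ler_expR -/d.
  have : s <= d by rewrite -sE expr2 ler_peMl ?ltW//; lra.
  by rewrite -mulr_natl; lra.
have : expR (- (s / 16)) <= 2 * expR (- (s / 8)).
  by apply: le_trans dl _; apply: le_trans up _; lra.
have -> : - (s / 8) = - (s / 16) + - (s / 16) by lra.
rewrite expRD; have e0 := expR_gt0 (- (s / 16)).
have : expR (- (s / 16)) * (1 + s / 16) <= 1.
  have := expR_ge1Dx (s / 16); rewrite -(ler_pM2l e0) -expRD addNr expR0.
  by [].
by move: (expR _) e0 => e e0; nra.
Qed.

End estimates.

(** * Coverings by caps *)

Section cap_cover.
Variable R : realType.
Local Notation gauss n := (rV_measure (@normal_prob R 0 1) n).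
Local Notation norm2 x := (Num.sqrt (inner x x)).

Lemma sphereE n (x : 'rV[R]_n) : sphere x -> inner x x = 1.
Proof.
by rewrite /sphere/= => x1; rewrite -[LHS](sqr_sqrtr (inner_ge0 x)) x1 expr1n.
Qed.

(** The smallest cosine [r] belongs to one of the caps, so [polar_cap r] still has volume [delta].
    Lowering the other cosines to [r] only enlarges their caps, and scaling passes from unit vectors
    to all [w]. *)
Lemma sphere_cap_cover n m (caps : set (set 'rV[R]_n.+2)) (delta : R) :
  (caps #= `I_m)%card ->
  (forall C, caps C -> is_cap C /\ normalized_volume C = delta) ->
  @sphere R n.+2 `<=` \bigcup_(C in caps) C -> delta < 1 / 2 ->
  exists (v : 'I_m -> 'rV[R]_n.+2) (r : R),
  [/\ forall j, inner (v j) (v j) = 1, 0 < r,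
      forall w, exists j, r * norm2 w <= inner (v j) w &
      delta%:E = gauss n.+2 (polar_cap r)].
Proof.
rewrite card_eq_sym => /card_set_bijP[f [fun_f _ surj_f]] capsP cov d2.
have H (j : 'I_m) : exists vt : 'rV[R]_n.+2 * R,
    [/\ inner vt.1 vt.1 = 1, f j = cap vt.1 vt.2 &
      delta%:E = gauss n.+2 (polar_cap (cos vt.2))].
  have [[v [th [sv _ fE]]] fd] := capsP _ (fun_f j (ltn_ord j)).
  exists (v, th); split => //=; first exact: sphereE.
  by rewrite -fd fE normalized_volume_cap gauss_cap//; exact: sphereE.
have [vt vtP] := choice H.
have r0 j : 0 < cos (vt j).2.
  have [_ _ E] := vtP j; rewrite ltNge; apply/negP => /(gauss_cap_half n.+1).
  by rewrite -E lee_fin leNgt d2.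
have in_cap x : sphere x -> exists j, cos (vt j).2 <= inner x (vt j).1.
  move=> sx; have [C capsC Cx] := cov x sx.
  have [i im fi] := surj_f _ capsC.
  have [_ fE _] := vtP (Ordinal im).
  by exists (Ordinal im); move: Cx; rewrite -fi; move: fE => /= -> [].
(* The minimum needs an index to start from; the cap covering the first basis vector provides
   one. *)
have [j0 _] : exists j, cos (vt j).2 <= inner (cons_row (1, 0)) (vt j).1.
  apply: in_cap; rewrite /sphere/= inner_e0 cons_row0/=; exact: sqrtr1.
pose j1 := [arg min_(j < j0) cos (vt j).2]%O.
have min1 j : cos (vt j1).2 <= cos (vt j).2.
  by rewrite /j1; case: arg_minP => // i _; apply.
have [_ _ E] := vtP j1.
exists (fun j => (vt j).1), (cos (vt j1).2); split => //.
  by move=> j; have [] := vtP j.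
move=> w; have [->|w0] := eqVneq w 0.
  by exists j0; rewrite -(scale0r (0 : 'rV[R]_n.+2)) innerZ innerZr !mul0r sqrtr0 mulr0.
have n0 := norm2_gt0 w0.
have [j jw] : exists j, cos (vt j).2 <= inner ((norm2 w)^-1 *: w) (vt j).1.
  apply: in_cap; rewrite /sphere/= norm2Z ?invr_ge0 ?sqrtr_ge0// mulVf// gt_eqF//.
exists j; rewrite innerC; move: jw; rewrite innerZl => jw.
rewrite mulrC -ler_pdivlMl//; exact: le_trans (min1 j) jw.
Qed.

Lemma cap_cover_density n m (caps : set (set 'rV[R]_n)) (delta : R) :
  (257 <= n)%N -> (caps #= `I_m)%card ->
  (forall C, caps C -> is_cap C /\ normalized_volume C = delta) ->
  @sphere R n `<=` \bigcup_(C in caps) C -> delta < 1 / 2 ->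
  expR (- (Num.sqrt n%:R / 16)) <= delta ->
  (n <= m)%N /\ cover_const R * n%:R <= m%:R * delta.
Proof.
case: n caps => [|[|n]]// caps n257 capsm capsP cov d2 dl.
have [v [r [v1 r0 cv dE]]] := sphere_cap_cover capsm capsP cov d2.
split; first exact: cover_card r0 cv.
have t4 := cap_height_upper r0 dE n257 dl.
by apply: (cover_volume v1 r0 cv dE t4); exact: leq_trans n257.
Qed.

Lemma ln2_le1 : ln 2 <= 1 :> R.
Proof.
rewrite -[leRHS]expRK ler_ln ?posrE ?expR_gt0//.
by have := expR_ge1Dx (1 : R).
Qed.

End cap_cover.

Theorem theorem7 (R : realType) (m : nat -> nat) (delta : nat -> R)
  (hlower : exists h : nat -> R,
     h =o_\oo (fun n : nat => Num.sqrt (n%:R : R)) /\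
     (\forall n \near \oo, 2 `^ (- h n) <= delta n))
  (hupper : \forall n \near \oo, delta n < 1 / 2)
  (hcover : \forall n \near \oo, exists caps : set (set 'rV[R]_n),
     [/\ (caps #= `I_(m n))%card,
         (forall C, caps C -> is_cap C /\ normalized_volume C = delta n)
       & @sphere R n `<=` \bigcup_(C in caps) C]) :
  delta =Omega_\oo (fun n : nat =>
    n%:R / ((m n)%:R * Num.sqrt (log2 (1 + (m n)%:R / n%:R))) : R).
Proof.
have [h [ho hd]] := hlower.
(* The little-o is used at the ratio [1 / 16] only: with [ln 2 <= 1] it turns the lower bound on
   [delta] into the one that [cap_height_upper] requires. *)
have {}ho : \forall n \near \oo, `|h n| <= 1 / 16 * `|Num.sqrt (n%:R : R)|.
  by move/eqoP : ho; apply.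
rewrite eqOmegaE; apply/asboolP; exists (cover_const R); first exact: cover_const_gt0.
near=> n.
have n257 : (257 <= n)%N by near: n; exact: nbhs_infty_ge.
have hn : `|h n| <= 1 / 16 * `|Num.sqrt (n%:R : R)| by near: n.
have dn : 2 `^ (- h n) <= delta n by near: n.
have d2 : delta n < 1 / 2 by near: n.
have [caps [capsm capsP cov]] : exists caps : set (set 'rV[R]_n),
     [/\ (caps #= `I_(m n))%card,
         (forall C, caps C -> is_cap C /\ normalized_volume C = delta n)
       & @sphere R n `<=` \bigcup_(C in caps) C] by near: n.
have dl : expR (- (Num.sqrt n%:R / 16)) <= delta n.
  apply: le_trans dn; rewrite /powR gt_eqF// ler_expR.
  move: hn; rewrite (ger0_norm (sqrtr_ge0 _)) => hn.
  have l0 : 0 <= ln 2 :> R by rewrite ln_ge0// ler1n.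
  have : `|h n| * ln 2 <= `|h n| by rewrite ler_piMr// ln2_le1.
  have : h n * ln 2 <= `|h n| * ln 2 by rewrite ler_wpM2r// ler_norm.
  lra.
have [nm main] := cap_cover_density n257 capsm capsP cov d2 dl.
have N0 : 0 < n%:R :> R by rewrite ltr0n (leq_trans _ n257).
have NM : n%:R <= (m n)%:R :> R by rewrite ler_nat.
have k0 := cover_const_gt0 R.
move: (cover_const R) (delta n) ((m n)%:R : R) (n%:R : R) k0 N0 NM main => k d M N k0 N0 NM
    main.
have M0 : 0 < M by exact: lt_le_trans NM.
have L1 : 1 <= Num.sqrt (log2 (1 + M / N)).
  have l2 : 0 < ln 2 :> R by rewrite ln_gt0// ltr1n.
  rewrite -[leLHS]sqrtr1 ler_wsqrtr// /log2 ler_pdivlMr// mul1r ler_ln ?posrE//.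
    have : 1 <= M / N by rewrite ler_pdivlMr// mul1r.
    lra.
  by rewrite addr_gt0// divr_gt0.
have L0 : 0 < Num.sqrt (log2 (1 + M / N)) by exact: lt_le_trans L1.
apply: le_trans (ler_norm d).
rewrite ger0_norm; last by rewrite divr_ge0 ?mulr_ge0 ?ltW.
have kN : k * (N / M) <= d by rewrite mulrA ler_pdivrMr// [d * M]mulrC.
apply: le_trans kN; rewrite (ler_pM2l k0) invfM mulrA.
by rewrite ler_piMr ?divr_ge0 ?(ltW N0) ?(ltW M0)// invf_le1.
Unshelve. all: by end_near. Qed.
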